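(* Let $\Sigma_0\in\mathbb{R}^{p\times p}$ be symmetric positive definite, $\mu$ a Borel probability measure on $\Omega$, $F:\Omega\to S_p$ and $\kappa:\Omega\to\mathbb{R}^p$ Borel measurable, where $S_p$ is the space of symmetric positive semidefinite $p\times p$ real matrices. Suppose $$\Pi(d\beta,d\omega)\propto\exp\left(\beta^T\kappa(\omega)-\tfrac12\beta^T\left[F(\omega)+\Sigma_0^{-1}\right]\beta\right)\mu(d\omega)\,d\beta$$ defines a probability measure on $\mathbb{R}^p\times\Omega$ (finite normalizing constant). Let $\Sigma(\omega)=(F(\omega)+\Sigma_0^{-1})^{-1}$ and assume $\sup_{\omega\in\Omega}\|\Sigma(\omega)\kappa(\omega)\|<\infty$. Let $$Z(\beta)=\int_\Omega\exp\left(\beta^T\kappa(\omega)-\tfrac12\beta^T\left[F(\omega)+\Sigma_0^{-1}\right]\beta\right)\mu(d\omega)$$ and assume that $\beta\mapsto Z(\beta)$ is finite and continuous. Let $P_G$ be the transition kernel on $\mathbb{R}^p$ of the marginal chain $(\beta^{(t)})_{t\ge0}$ of the two-variable Gibbs sampler for $\Pi$. Then this chain is hyper-$V$ uniformly ergodic for $V(\beta)=\|\beta\|^2$; that is, there are $\alpha\in(0,1)$ and $K>0$ such that for all $\beta\in\mathbb{R}^p$ and all integers $t\ge1$, $$\left\|P_G^{2t}(\beta,\cdot)-\Pi(\cdot\times\Omega)\right\|_{\mathrm{TV}}\le(1-\alpha)^t,$$ $$\left\|P_G^{2t+1}(\beta,\cdot)-\Pi(\cdot\times\Omega)\right\|_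{1+V}\le2(1+K)(1-\alpha)^t.$$
   Context: Gibbs sampler: given $\beta^{(t)}$, sample $\omega^{(t+1)}\sim\Pi(d\omega\mid\beta^{(t)})$, the conditional law with density $\omega\mapsto Z(\beta)^{-1}\exp\left(\beta^T\kappa(\omega)-\tfrac12\beta^T[F(\omega)+\Sigma_0^{-1}]\beta\right)$ with respect to $\mu$ at $\beta=\beta^{(t)}$; then sample $\beta^{(t+1)}\mid\omega^{(t+1)}\sim N_p(m(\omega^{(t+1)}),\Sigma(\omega^{(t+1)}))$ with $m(\omega)=\Sigma(\omega)\kappa(\omega)$. $P_G$ is the transition kernel of $\beta^{(t)}\mapsto\beta^{(t+1)}$, and $\Pi(\cdot\times\Omega)$ is the $\beta$-marginal of $\Pi$. $\|\cdot\|$ is the Euclidean norm on vectors. $P^t$ is the $t$-step kernel, $Pf(\beta)=\int f\,dP(\beta,\cdot)$. For a probability measure $\pi$ on $\mathbb{R}^p$: $\|P^t(\beta,\cdot)-\pi\|_{\mathrm{TV}}=\sup_{f:\mathbb{R}^p\to[0,1]\text{ Borel}}|P^tf(\beta)-\int f\,d\pi|$, and for $W\ge0$ Borel, $\|P^t(\beta,\cdot)-\pi\|_{W}=\sup_{|f|\le W,\ f\text{ Borel}}|P^tf(\beta)-\int f\,d\pi|$. *)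

(* Defs.v *)
From HB Require Import structures.
From mathcomp Require Import all_boot all_order all_algebra.
From mathcomp Require Import all_classical all_reals all_analysis.
From mathcomp Require Import measurable_realfun.

Set Implicit Arguments.
Unset Strict Implicit.
Unset Printing Implicit Defensive.

Import Order.TTheory GRing.Theory Num.Theory.
Import numFieldNormedType.Exports.

Local Open Scope classical_set_scope.
Local Open Scope ring_scope.

(* The Borel sigma-algebra on real matrices, hence on R^p := 'cV[R]_p. *)
HB.instance Definition _ (R : realType) (m n : nat) :=
  @isMeasurable.Build (sigma_display (@open 'M[R]_(m, n))) 'M[R]_(m, n)
    <<s @open 'M[R]_(m, n) >>
    (@sigma_algebra0 _ setT _) (@sigma_algebraC _ _)
    (@sigma_algebra_bigcup _ setT _).

Section borel_matrix.
Context {R : realType}.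

Lemma open_measurable_mx m n (U : set 'M[R]_(m, n)) : open U -> measurable U.
Proof. exact: sub_gen_smallest. Qed.

Lemma continuous_measurable_mx m n m' n' (f : 'M[R]_(m, n) -> 'M[R]_(m', n')) :
  continuous f -> measurable_fun setT f.
Proof.
move=> /continuousP cf; apply: (measurability (@open 'M[R]_(m', n'))) => //.
move=> _ [U oU <-]; rewrite setTI; apply: open_measurable_mx; exact: cf.
Qed.

Lemma measurable_mx_entry m n (i : 'I_m) (j : 'I_n) :
  measurable_fun setT (fun M : 'M[R]_(m, n) => M i j).
Proof.
apply: (measurability (@RGenOpens.G R)) => [|_ [_ [a [b ->]] <-]].
  exact: RGenOpens.measurableE.
rewrite setTI; apply: open_measurable_mx.
have /continuousP := @coord_continuous R m n i j; apply.
exact: interval_open.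
Qed.

Lemma measurable_mxP d (T : measurableType d) m n (f : T -> 'M[R]_(m, n)) :
  (forall i j, measurable_fun setT (fun x => f x i j)) ->
  measurable_fun setT f.
Proof.
move=> mf; apply: (measurability (@open 'M[R]_(m, n))) => // _ [U oU <-].
pose box (q : 'M[rat]_(m, n) * rat) : set 'M[R]_(m, n) :=
  [set M | forall i j, ball (ratr (q.1 i j) : R) (ratr q.2) (M i j)].
pose D := [set q | box q `<=` U].
have -> : U = \bigcup_q (if q \in D then box q else set0).
  apply/seteqP; split=> [M UM|M [q _]]; last first.
    by case: ifPn => // /set_mem; exact.
  have /nbhs_ballP[e /= e0 eU] : nbhs M U by exact: open_nbhs_nbhs.
  have /rat_in_itvoo[r] : 0 < e / 2 by rewrite divr_gt0.
  rewrite in_itv/= => /andP[r0 re].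
  have /fin_all_exists[q Mq] (i : 'I_m) : exists q : {ffun 'I_n -> rat},
      forall j, ball (ratr (q j) : R) (ratr r) (M i j).
    have /fin_all_exists[q Mq] (j : 'I_n) :
        exists q : rat, ball (ratr q : R) (ratr r) (M i j).
      have : M i j - ratr r < M i j + ratr r.
        by rewrite ltrBlDr -addrA ltrDl addr_gt0.
      move=> /rat_in_itvoo[q]; rewrite in_itv/= => /andP[Mq qM].
      exists q; rewrite ball_itv/= in_itv/=.
      by rewrite ltrBlDr qM -ltrBlDr Mq.
    by exists [ffun j => q j] => j; rewrite ffunE.
  exists (\matrix_(i, j) q i j, r) => //.
  rewrite ifT; last first.
    apply/mem_set => N Nq; apply: eU; split=> // i j.
    have qN : ball (ratr (q i j) : R) (e / 2) (N i j).
      by apply: (le_ball (ltW re)); have := Nq i j; rewrite /= mxE.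
    have qM : ball (M i j) (e / 2) (ratr (q i j) : R).
      by apply/ball_sym/(le_ball (ltW re)).
    by have := ball_triangle qM qN; rewrite -splitr.
  by move=> i j; rewrite /= mxE.
rewrite setTI preimage_bigcup; apply: countable_bigcupT_measurable => [|q].
  exact: countableP.
case: ifPn => _; last by rewrite preimage_set0.
rewrite [X in measurable X](_ : _ = \bigcap_(i in [set: 'I_m])
    \bigcap_(j in [set: 'I_n])
      (setT `&` (fun x => f x i j) @^-1` ball (ratr (q.1 i j) : R) (ratr q.2))).
  apply: fin_bigcap_measurable => // i _; apply: fin_bigcap_measurable => // j _.
  by apply: mf => //; exact: measurable_ball.
apply/seteqP; split=> [x fx i _ j _|x fx i j]; first by split=> //; exact: fx.
by have [] := fx i I j I.
Qed.
End borel_matrix.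

Section lebesgue_measure_cV.
Context {R : realType}.

Definition cV_cons n (z : R * 'cV[R]_n) : 'cV[R]_n.+1 :=
  col_mx z.1%:M z.2 : 'cV[R]_(1 + n).

Definition cV_uncons n (v : 'cV[R]_n.+1) : R * 'cV[R]_n :=
  (v ord0 ord0, dsubmx (v : 'cV[R]_(1 + n))).

Lemma cV_consK n : cancel (@cV_cons n) (@cV_uncons n).
Proof.
move=> [x v]; rewrite /cV_cons /cV_uncons/=; congr pair.
  by rewrite mxE; case: splitP => // j _; rewrite ord1 mxE eqxx.
by rewrite col_mxKd.
Qed.

Lemma cV_unconsK n : cancel (@cV_uncons n) (@cV_cons n).
Proof.
move=> v; rewrite /cV_cons /cV_uncons/=.
rewrite -[RHS](@vsubmxK R 1 n 1 v); congr (@col_mx R 1 n 1 _ _)%R.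
apply/colP => i; rewrite !ord1 !mxE eqxx mulr1n.
by congr (v _ _); exact: val_inj.
Qed.

Lemma cV_cons0 n (z : R * 'cV[R]_n) : cV_cons z ord0 ord0 = z.1.
Proof. by rewrite -[z in RHS]cV_consK. Qed.

Lemma cV_consS n (z : R * 'cV[R]_n) i : cV_cons z (lift ord0 i) ord0 = z.2 i ord0.
Proof.
rewrite /cV_cons (_ : lift ord0 i = rshift 1 i); last exact: val_inj.
by rewrite (@col_mxEd _ 1).
Qed.

Lemma measurable_cV_cons n : measurable_fun setT (@cV_cons n).
Proof.
apply: measurable_mxP => i j; rewrite [j]ord1.
case: (unliftP ord0 i) => [k ->|->].
  under eq_fun do rewrite cV_consS.
  apply: (measurableT_comp (measurable_mx_entry k ord0)).
  exact: measurable_snd.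
under eq_fun do rewrite cV_cons0.
exact: measurable_fst.
Qed.

Lemma measurable_cV_uncons n : measurable_fun setT (@cV_uncons n).
Proof.
apply/measurable_fun_pairP; split; first exact: measurable_mx_entry.
apply: measurable_mxP => i j.
rewrite (_ : (fun _ => _) = fun v : 'cV[R]_n.+1 => v (rshift 1 i) j).
  exact: measurable_mx_entry.
by apply/funext => v /=; rewrite mxE.
Qed.

Section step.
Variables (n : nat) (m : {sigma_finite_measure set 'cV[R]_n -> \bar R}).

Definition lebesgue_cV_step : set 'cV[R]_n.+1 -> \bar R :=
  pushforward (@lebesgue_measure R \x m)%E (@cV_cons n).

Let measurable_cons A : measurable A -> measurable (@cV_cons n @^-1` A).
Proof.
by move=> mA; rewrite -[X in measurable X]setTI; exact: measurable_cV_cons.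
Qed.

Let step0 : lebesgue_cV_step set0 = 0%E.
Proof. by rewrite /lebesgue_cV_step /pushforward preimage_set0 measure0. Qed.

Let step_ge0 A : (0 <= lebesgue_cV_step A)%E.
Proof. by rewrite /lebesgue_cV_step /pushforward measure_ge0. Qed.

Let step_sigma_additive : semi_sigma_additive lebesgue_cV_step.
Proof.
move=> F mF tF mUF; rewrite /lebesgue_cV_step /pushforward preimage_bigcup.
apply: measure_semi_sigma_additive.
- by move=> k; exact: measurable_cons.
- apply/trivIsetP => /= i j _ _ ij; rewrite -preimage_setI.
  by move/trivIsetP : tF => /(_ _ _ _ _ ij) ->//; rewrite preimage_set0.
- by rewrite -preimage_bigcup; exact: measurable_cons.
Qed.

HB.instance Definition _ := isMeasure.Build _ _ _ lebesgue_cV_step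
  step0 step_ge0 step_sigma_additive.

Let step_sigma_finite : sigma_finite setT lebesgue_cV_step.
Proof.
have /sigma_finiteP[F [FT ndF Foo]] := sigma_finiteT (@lebesgue_measure R).
have /sigma_finiteP[G [GT ndG Goo]] := sigma_finiteT m.
exists (fun k => @cV_uncons n @^-1` (F k `*` G k)).
  rewrite -preimage_bigcup (_ : \bigcup_k _ = setT) ?preimage_setT//.
  apply/seteqP; split=> // -[x y] _.
  have [i _ Fx] : (\bigcup_k F k) x by rewrite -FT.
  have [j _ Gy] : (\bigcup_k G k) y by rewrite -GT.
  exists (maxn i j) => //; split.
    by move: x Fx; exact/subsetPset/ndF/leq_maxl.
  by move: y Gy; exact/subsetPset/ndG/leq_maxr.
move=> k; have [mF Fk] := Foo k; have [mG Gk] := Goo k; split.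
  rewrite -[X in measurable X]setTI; apply: measurable_cV_uncons => //.
  exact: measurableX.
rewrite /lebesgue_cV_step /pushforward -comp_preimage.
rewrite (_ : _ \o _ = id); last by apply/funext; exact: cV_consK.
by rewrite preimage_id product_measure1E// lte_mul_pinfty// ge0_fin_numE.
Qed.

HB.instance Definition _ := Measure_isSigmaFinite.Build _ _ _ lebesgue_cV_step
  step_sigma_finite.

End step.

(* Lebesgue measure on R^n, one coordinate at a time; lebesgue_cV_box below
   gives the values on boxes, which determine it. *)
Fixpoint lebesgue_cV n : {sigma_finite_measure set 'cV[R]_n -> \bar R} :=
  if n is n'.+1 then lebesgue_cV_step (lebesgue_cV n') else \d_(0 : 'cV[R]_0).

End lebesgue_measure_cV.

Lemma lebesgue_cV_box (R : realType) n (A : 'I_n -> set R) :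
  (forall i, measurable (A i)) ->
  lebesgue_cV n [set v : 'cV[R]_n | forall i, A i (v i ord0)] =
  (\prod_(i < n) lebesgue_measure (A i : set (measurableTypeR R)))%E.
Proof.
elim: n A => [A _|n IH A mA].
  rewrite big_ord0 /= diracE mem_set//.
  by case.
rewrite big_ord_recl -IH// -product_measure1E//; first last.
  rewrite [X in measurable X](_ : _ = \bigcap_(i in [set: 'I_n])
      (setT `&` (fun v : 'cV[R]_n => v i ord0) @^-1` A (lift ord0 i))).
    apply: fin_bigcap_measurable => // i _.
    by apply: measurable_mx_entry => //; exact: mA.
  apply/seteqP; split=> [v Av i _|v Av i]; first by split=> //; exact: Av.
  by have [] := Av i I.
  exact: mA.
change ((@lebesgue_measure R \x lebesgue_cV n)%E
  (@cV_cons R n @^-1` [set v : 'cV[R]_n.+1 | forall i, A i (v i ord0)]) =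
  (@lebesgue_measure R \x lebesgue_cV n)%E
  (A ord0 `*` [set v : 'cV[R]_n | forall i, A (lift ord0 i) (v i ord0)])).
congr ((_ \x _)%E _).
apply/seteqP; split=> [[x v] /= Axv|[x v] /= [Ax Av] i].
  split=> [|i]; first by have := Axv ord0; rewrite cV_cons0.
  by have := Axv (lift ord0 i); rewrite cV_consS.
by case: (unliftP ord0 i) => [j ->|->]; rewrite ?cV_consS ?cV_cons0//; exact: Av.
Qed.

Section linear_algebra.
Context {R : realType} {p : nat}.
Implicit Types (S : 'M[R]_p) (x y : 'cV[R]_p).

Definition dotv x y : R := (x^T *m y) ord0 ord0.

Definition qform S x : R := (x^T *m S *m x) ord0 ord0.

(* The library norm on matrices is the sup norm. *)
Definition enorm x : R := Num.sqrt (\sum_i x i ord0 ^+ 2).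

Definition sym_posdef S := S^T = S /\ forall x, x != 0 -> 0 < qform S x.

Definition sym_possemidef S := S^T = S /\ forall x, 0 <= qform S x.

End linear_algebra.

Section multivariate_normal.
Context {R : realType} {p : nat}.
Implicit Types (m x : 'cV[R]_p) (S : 'M[R]_p).

(* Density of N_p(m, S); meaningful for S symmetric positive definite. *)
Definition multinormal_pdf m S x : R :=
  (Num.sqrt ((2 * pi) ^+ p * \det S))^-1 *
  expR (- (2^-1 * qform (invmx S) (x - m))).

Definition multinormal m S (A : set 'cV[R]_p) : \bar R :=
  (\int[lebesgue_cV p]_(x in A) (multinormal_pdf m S x)%:E)%E.

End multivariate_normal.

Section ergodicity.
Local Open Scope ereal_scope.
Context d (T : measurableType d) (R : realType).
Implicit Types (P : T -> set T -> \bar R) (nu pi : set T -> \bar R).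

Fixpoint kernel_iter P (t : nat) (x : T) (A : set T) : \bar R :=
  if t is t'.+1 then \int[P x]_y kernel_iter P t' y A else \d_x A.

(* Integrals and differences are extended reals: since `|+oo - +oo| = +oo, a
   finite bound on these distances also asserts that, for every admissible f,
   both integrals are finite. *)
Definition tv_dist nu pi : \bar R :=
  ereal_sup [set `| \int[nu]_x (f x)%:E - \int[pi]_x (f x)%:E | | f in
    [set f : T -> R | measurable_fun setT f /\ forall x, (0 <= f x <= 1)%R]].

Definition weighted_dist (W : T -> R) nu pi : \bar R :=
  ereal_sup [set `| \int[nu]_x (f x)%:E - \int[pi]_x (f x)%:E | | f in
    [set f : T -> R | measurable_fun setT f /\ forall x, (`|f x| <= W x)%R]].

Definition hyper_uniformly_ergodic (V : T -> R) P pi :=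
  exists alpha K : R, [/\ (0 < alpha < 1)%R, (0 < K)%R &
    forall (x : T) (t : nat), (1 <= t)%N ->
      tv_dist (kernel_iter P (2 * t) x) pi <= ((1 - alpha) ^+ t)%:E /\
      weighted_dist (fun y => 1 + V y)%R (kernel_iter P (2 * t + 1) x) pi
        <= (2 * (1 + K) * (1 - alpha) ^+ t)%:E].

End ergodicity.

Section gibbs_sampler.
Context {R : realType} {p : nat} d (Omega : measurableType d).
Variables (Sigma0 : 'M[R]_p) (F : Omega -> 'M[R]_p) (kappa : Omega -> 'cV[R]_p)
  (mu : probability Omega R).
Implicit Types (beta : 'cV[R]_p) (omega : Omega).

Definition gibbs_weight beta omega : R :=
  expR (dotv beta (kappa omega) -
        2^-1 * qform (F omega + invmx Sigma0) beta).

Definition gibbs_Z beta : \bar R :=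
  (\int[mu]_omega (gibbs_weight beta omega)%:E)%E.

Definition cond_cov omega : 'M[R]_p := invmx (F omega + invmx Sigma0).

Definition cond_mean omega : 'cV[R]_p := cond_cov omega *m kappa omega.

(* The conditional law of omega given beta, with density w.r.t. mu. *)
Definition cond_omega beta (A : set Omega) : \bar R :=
  (\int[mu]_(omega in A)
     ((fine (gibbs_Z beta))^-1 * gibbs_weight beta omega)%:E)%E.

(* One sweep of the sampler: omega given beta, then a new beta given omega. *)
Definition gibbs_kernel beta (A : set 'cV[R]_p) : \bar R :=
  (\int[cond_omega beta]_omega
     multinormal (cond_mean omega) (cond_cov omega) A)%E.

(* Pi(dbeta, domega) is proportional to gibbs_weight * mu(domega) dbeta; as Pi
   has total mass 1, this forces the normalizing constant to be finite. *)
Definition gibbs_target (Pi : probability ('cV[R]_p * Omega)%type R) :=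
  exists2 c : R, 0 < c & forall A, measurable A ->
    Pi A = (c%:E * \int[lebesgue_cV p \x mu]_(z in A)
                     (gibbs_weight z.1 z.2)%:E)%E.

End gibbs_sampler.

(* Main.v *)
Require Import Defs.
From HB Require Import structures.
From mathcomp Require Import all_boot all_order all_algebra.
From mathcomp Require Import all_classical all_reals all_analysis.
From mathcomp Require Import measurable_realfun.
From mathcomp Require Import lra ring.

Set Implicit Arguments.
Unset Strict Implicit.
Unset Printing Implicit Defensive.

Import Order.TTheory GRing.Theory Num.Theory.
Import numFieldNormedType.Exports.

Local Open Scope classical_set_scope.
Local Open Scope ring_scope.

(** The chain forgets its starting point in two steps, and one step brings its
second moment below a constant that does not depend on where it starts.

Write A(omega) = F(omega) + Sigma0^-1 for the conditional precision, S(omega)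
for its inverse, m(omega) for the conditional mean and w(beta, omega) for the
unnormalized joint density.

Drift.  Given omega, the new beta is N(m(omega), S(omega)).  The means are
bounded by hypothesis and A(omega) dominates Sigma0^-1, so E|beta|^2 is at most
a constant K whatever the previous state (gibbs_pker_drift).  By Chebyshev, one
step lands in the ball C = {|beta|^2 <= 2 K} with probability at least 1/2
(gibbs_pker_ball).

Minorization.  From a state in C the law of omega has density w / Z.  On C, the
normalizer Z is bounded by some B, because it is continuous, and w(beta, omega)
is at least a positive function g(omega) (gibbs_weight_lower_bound).  Hence one
step from C dominates the measure B^-1 int g(omega) N(m(omega), S(omega)) mu,
and two steps from anywhere dominate half of it (gibbs_pker_minorization).  Its
mass alpha lies in (0, 1).

Ergodicity.  With a common part of mass alpha, two steps of the chain multiply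
the oscillation of a bounded function by 1 - alpha at most (doeblin_step).  The
mean of f under the invariant law lies between the extreme values of P^(2t) f,
which gives the total variation bound (doeblin_dist).  For |f| <= 1 + V, one
step makes P f bounded by 1 + K, so its oscillation is at most 2 (1 + K), and
the other 2 t steps contract it (weighted_doeblin_dist).

Invariance of the beta-marginal of Pi is Tonelli's theorem, once the normal
density N(m(omega), S(omega)) is recognized as w(., omega) divided by its
integral (multinormal_pdf_gibbs, gibbs_pker_invariant).  This recognition is a
completion of the square together with the value of the Gaussian integral on
R^n (integral_gauss), obtained by integrating one coordinate at a time: the
quadratic form that remains is the Schur complement.  The same formula bounds
the second moment, since u <= 4 exp(u / 4) turns the quadratic factor into a
Gaussian with halved precision (integral_qform_multinormal_pdf). *)

(** * Kernels with a density and composition of kernels *)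

Section integral_set_function.
Local Open Scope ereal_scope.
Context d (T : measurableType d) (R : realType).
Import HBNNSimple.

(** The integral reads its set function only on level sets of simple functions,
which are measurable; a set function defined by an integral can thus be
exchanged for the bundled measure it agrees with. *)
Lemma eq_set_function_integral (m1 m2 : set T -> \bar R) (D : set T)
    (f : T -> \bar R) :
  (forall A, measurable A -> m1 A = m2 A) ->
  \int[m1]_(x in D) f x = \int[m2]_(x in D) f x.
Proof.
move=> m12; have m12s (h : {nnsfun T >-> R}) : sintegral m1 h = sintegral m2 h.
  by apply: eq_fsbigr => r _; rewrite m12.
rewrite /integral; congr (ereal_sup _ - ereal_sup _);
  by apply: eq_imagel => h _; exact: m12s.
Qed.

End integral_set_function.

Section mkcomp_noparam_pker.
Local Open Scope ereal_scope.
Context d0 d1 d2 (T0 : measurableType d0) (T1 : measurableType d1)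
  (T2 : measurableType d2) (R : realType)
  (k1 : R.-pker T0 ~> T1) (k2 : R.-pker T1 ~> T2).

Let prob_mkcomp_noparam x : mkcomp_noparam k1 k2 x setT = 1.
Proof.
transitivity (\int[k1 x]__ (1 : \bar R)).
  by apply: eq_integral => y _; rewrite prob_kernel.
by rewrite integral_cst// mul1e prob_kernel.
Qed.

HB.instance Definition _ := @isProbabilityKernel.Build _ _ _ _ _
  (mkcomp_noparam k1 k2) prob_mkcomp_noparam.

Lemma integral_mkcomp_noparam (x : T0) (f : T2 -> \bar R) :
  (forall z, 0 <= f z) -> measurable_fun setT f ->
  \int[mkcomp_noparam k1 k2 x]_z f z = \int[k1 x]_y \int[k2 y]_z f z.
Proof.
move=> f0 mf; exact: (@integral_kcomp _ _ _ _ _ _ _ k1 (kernel.kernel_snd k2) x).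
Qed.

End mkcomp_noparam_pker.

(** Otherwise f would vanish almost everywhere and setT would be null. *)
Lemma integral_gt0 d (T : measurableType d) (R : realType)
    (m : {measure set T -> \bar R}) (f : T -> \bar R) :
  measurable_fun setT f -> (forall x, 0 < f x)%E -> m setT != 0%E ->
  (0 < \int[m]_x f x)%E.
Proof.
move=> mf f0 mT; rewrite lt0e integral_ge0 ?andbT; last by move=> x _; exact/ltW.
apply: contra_neq mT => If0.
have /(ae_eq_integral_abs m measurableT mf) [N [mN N0 sN]] :
    (\int[m]_(x in setT) `|f x| = 0)%E.
  by rewrite -If0; apply: eq_integral => x _; rewrite gee0_abs ?ltW.
have : (m setT <= m N)%E.
  apply: le_measure; rewrite ?inE// => x _; apply: sN => /(_ I) fx0.
  by have := f0 x; rewrite fx0 ltxx.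
by rewrite N0 measure_le0 => /eqP.
Qed.

Section integral_density.
Local Open Scope ereal_scope.
Context d (T : measurableType d) (R : realType).
Variables (m n : {measure set T -> \bar R}) (g : T -> R).
Hypothesis g0 : forall x, (0 <= g x)%R.
Hypothesis mg : measurable_fun setT g.
Hypothesis nE : forall A, measurable A -> n A = \int[m]_(x in A) (g x)%:E.
Import HBNNSimple.

Let mEg : measurable_fun setT (EFin \o g).
Proof. exact/measurable_EFinP. Qed.

Let integral_density_nnsfun (h : {nnsfun T >-> R}) :
  \int[n]_x (h x)%:E = \int[m]_x ((g x)%:E * (h x)%:E).
Proof.
under [in LHS]eq_integral do rewrite fimfunE -fsumEFin//.
rewrite ge0_integral_fsum//; last 2 first.
  - by move=> r; exact/measurable_EFinP/measurableT_comp.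
  - by move=> r z _; rewrite EFinM nnfun_muleindic_ge0.
under [in RHS]eq_integral.
  move=> x _; rewrite fimfunE -fsumEFin// ge0_mule_fsumr; last first.
    by move=> r; rewrite EFinM nnfun_muleindic_ge0.
  over.
rewrite ge0_integral_fsum//; last 2 first.
  - move=> r; apply: emeasurable_funM => //.
    exact/measurable_EFinP/measurableT_comp.
  - by move=> r z _; rewrite mule_ge0 ?lee_fin// -lee_fin EFinM nnfun_muleindic_ge0.
apply: eq_fsbigr => r _.
rewrite (integralZl_indic _ (fun r => h @^-1` [set r]))//; last first.
  by move=> r0; rewrite preimage_nnfun0.
rewrite integral_indic// setIT nE//.
have [r0|r0] := ltP r 0%R.
  rewrite preimage_nnfun0// integral_set0 mule0; apply/esym/integral0_eq => x _.
  by rewrite indic0 mulr0 mule0.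
rewrite -ge0_integralZl//; last 2 first.
  - exact: measurable_funS mEg.
  - by move=> x _; rewrite lee_fin.
rewrite integral_mkcond; apply: eq_integral => x _.
rewrite /patch indicE; case: (x \in _); first by rewrite mulr1 muleC.
by rewrite mulr0 mule0.
Qed.

(** On a simple function this is nE on each level set; monotone convergence
gives the rest. *)
Lemma ge0_integral_density (f : T -> \bar R) : (forall x, 0 <= f x) ->
  measurable_fun setT f -> \int[n]_x f x = \int[m]_x ((g x)%:E * f x).
Proof.
move=> f0 mf; pose f_ := nnsfun_approx measurableT mf.
transitivity (\int[n]_x lim ((f_ k x)%:E @[k --> \oo])).
  by apply/eq_integral => z _; apply/esym/cvg_lim => //=; exact: cvg_nnsfun_approx.
rewrite monotone_convergence//; last 3 first.
  by move=> k; exact/measurable_EFinP.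
  by move=> k z _; rewrite lee_fin.
  by move=> z _ a b ab; rewrite lee_fin; exact/lefP/nd_nnsfun_approx.
under eq_fun do rewrite integral_density_nnsfun.
rewrite -monotone_convergence//; last 3 first.
  by move=> k; apply: emeasurable_funM => //; exact/measurable_EFinP.
  by move=> k z _; rewrite mule_ge0// lee_fin.
  move=> z _ a b ab; rewrite lee_wpmul2l ?lee_fin//.
  exact/lefP/nd_nnsfun_approx.
apply: eq_integral => x _; apply/cvg_lim => //.
by apply: cvgeZl => //; exact: cvg_nnsfun_approx.
Qed.

End integral_density.

Section density_kernel.
Local Open Scope ereal_scope.
Context d d' (X : measurableType d) (Y : measurableType d') (R : realType).
Variables (m : {sigma_finite_measure set Y -> \bar R}) (g : X * Y -> R).
Hypothesis g0 : forall z, (0 <= g z)%R.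
Hypothesis mg : measurable_fun setT g.

Let mgx x : measurable_fun setT (fun y => g (x, y)).
Proof. exact: measurableT_comp. Qed.

(** The proofs are arguments so that the measure and kernel instances, which
rest on them, can be attached to this definition. *)
Definition kdensity (_ : forall z, (0 <= g z)%R) (_ : measurable_fun setT g)
  (x : X) (A : set Y) : \bar R := \int[m]_(y in A) (g (x, y))%:E.

Local Notation kd := (kdensity g0 mg).

Let kdensity0 x : kd x set0 = 0.
Proof. by rewrite /kdensity integral_set0. Qed.

Let kdensity_ge0 x A : 0 <= kd x A.
Proof. by apply: integral_ge0 => y _; rewrite lee_fin. Qed.

Let kdensity_sigma_additive x : semi_sigma_additive (kd x).
Proof.
move=> F mF tF mUF; rewrite /kdensity ge0_integral_bigcup//; last 2 first.
- by apply/measurable_EFinP; exact: measurable_funS (mgx x).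
- by move=> y _; rewrite lee_fin.
apply: is_cvg_nneseries_cond => k _ _; apply: integral_ge0 => y _.
by rewrite lee_fin.
Qed.

HB.instance Definition _ x := isMeasure.Build _ _ _ (kd x)
  (kdensity0 x) (kdensity_ge0 x) (@kdensity_sigma_additive x).

Definition mkdensity : X -> {measure set Y -> \bar R} := kd.

Let measurable_kdensity U : measurable U -> measurable_fun setT (mkdensity ^~ U).
Proof.
move=> mU.
have mf : measurable_fun setT (fun z : X * Y => (g z * \1_U z.2)%:E).
  apply/measurable_EFinP/measurable_funM => //.
  by apply: measurableT_comp => //; exact: measurable_snd.
have f0 z : 0 <= (g z * \1_U z.2)%:E by rewrite lee_fin mulr_ge0.
rewrite [X in measurable_fun _ X](_ : _ = fubini_F m (fun z => (g z * \1_U z.2)%:E)).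
  exact: measurable_fun_fubini_tonelli_F.
apply/funext => x; rewrite /mkdensity /= /kdensity /fubini_F [LHS]integral_mkcond.
apply: eq_integral => y _; rewrite /patch indicE /=.
by case: (y \in U); rewrite ?mulr1 ?mulr0.
Qed.

HB.instance Definition _ := @isKernel.Build _ _ _ _ _ mkdensity measurable_kdensity.

Lemma integral_kdensity x (f : Y -> \bar R) : (forall y, 0 <= f y) ->
  measurable_fun setT f ->
  \int[mkdensity x]_y f y = \int[m]_y ((g (x, y))%:E * f y).
Proof. by move=> f0 mf; apply: ge0_integral_density. Qed.

End density_kernel.

Section density_pker.
Local Open Scope ereal_scope.
Context d d' (X : measurableType d) (Y : measurableType d') (R : realType).
Variables (m : {sigma_finite_measure set Y -> \bar R}) (g : X * Y -> R).
Hypothesis g0 : forall z, (0 <= g z)%R.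
Hypothesis mg : measurable_fun setT g.
Hypothesis g1 : forall x, \int[m]_y (g (x, y))%:E = 1.

(** A name of its own, carrying the proof that the density has mass one, for the
probability kernel instance. *)
Definition pdensity (_ : forall x, \int[m]_y (g (x, y))%:E = 1) := mkdensity m g0 mg.
HB.instance Definition _ := Kernel.on (pdensity g1).
HB.instance Definition _ := @Kernel_isProbability.Build _ _ _ _ _ (pdensity g1) g1.
End density_pker.

(** * Ergodicity from a drift condition and a two-step minorization *)

Section markov_operator.
Local Open Scope ereal_scope.
Context d (T : measurableType d) (R : realType) (P : R.-pker T ~> T).

Fixpoint kernel_pow (n : nat) : R.-pker T ~> T :=
  if n is n'.+1 then mkcomp_noparam P (kernel_pow n')
  else kdirac (@measurable_id _ T setT).

Definition markov_op (f : T -> \bar R) (x : T) : \bar R := \int[P x]_y f y.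

Lemma markov_op_ge0 f : (forall x, 0 <= f x) -> forall x, 0 <= markov_op f x.
Proof. by move=> f0 x; exact: integral_ge0. Qed.

Lemma measurable_markov_op f : (forall x, 0 <= f x) -> measurable_fun setT f ->
  measurable_fun setT (markov_op f).
Proof.
move=> f0 mf; apply: measurable_fun_integral_kernel => // U mU.
exact: measurable_kernel.
Qed.

Lemma iter_markov_op_ge0 n f : (forall x, 0 <= f x) -> forall x, 0 <= iter n markov_op f x.
Proof. by move=> f0; elim: n => // n IH; exact: markov_op_ge0. Qed.

Lemma measurable_iter_markov_op n f : (forall x, 0 <= f x) -> measurable_fun setT f ->
  measurable_fun setT (iter n markov_op f).
Proof.
move=> f0 mf; elim: n => // n IH; apply: measurable_markov_op => //.
exact: iter_markov_op_ge0.
Qed.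

Lemma integral_kernel_pow n x f : (forall x, 0 <= f x) -> measurable_fun setT f ->
  \int[kernel_pow n x]_y f y = iter n markov_op f x.
Proof.
move=> f0 mf; elim: n x => [|n IH] x.
  by rewrite /= /kdirac integral_dirac//= diracT mul1e.
rewrite [LHS]integral_mkcomp_noparam//=; apply: eq_integral => y _; exact: IH.
Qed.

Lemma kernel_pow_indic n x U : measurable U ->
  kernel_pow n x U = iter n markov_op (fun y => (\1_U y)%:E) x.
Proof.
move=> mU; rewrite -integral_kernel_pow//; last exact/measurable_EFinP.
by rewrite integral_indic// setIT.
Qed.

Lemma kernel_iterE (P0 : T -> set T -> \bar R) n x A :
  (forall x A, measurable A -> P0 x A = P x A) ->
  measurable A -> kernel_iter P0 n x A = kernel_pow n x A.
Proof.
move=> PE mA; elim: n x => [//|n IH] x /=.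
rewrite (eq_set_function_integral _ _ (PE x)).
by apply: eq_integral => y _; exact: IH.
Qed.

End markov_operator.

Section doeblin.
Local Open Scope ereal_scope.
Context d (T : measurableType d) (R : realType) (P : R.-pker T ~> T).
Variables (nu : {measure set T -> \bar R}) (alpha : R).
Hypothesis alpha01 : (0 <= alpha <= 1)%R.
Hypothesis nuT : nu setT = alpha%:E.
Hypothesis nuP : forall x A, measurable A -> nu A <= kernel_pow P 2 x A.

(** The measure nu is a common part of all the two-step laws. Comparison with nu
bounds the mean of h = f - a from below by nu(h), and the mean of s - h from
below by alpha s - nu(h). Both bounds are the same for every starting point, and
together they leave an interval of length (1 - alpha) s. The bounds a and c are
kept nonnegative so that only integrals of nonnegative functions occur. *)
Lemma doeblin_step (f : T -> \bar R) (a s : R) :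
  (0 <= a)%R -> (0 <= s)%R -> measurable_fun setT f ->
  (forall x, a%:E <= f x <= (a + s)%:E) ->
  exists2 c : R, (0 <= c)%R & forall x,
    c%:E <= iter 2 (markov_op P) f x <= (c + (1 - alpha) * s)%:E.
Proof.
move=> a0 s0 mf fas.
have f0 x : 0 <= f x.
  by have /andP[+ _] := fas x; apply: le_trans; rewrite lee_fin.
have ffin x : f x \is a fin_num.
  rewrite ge0_fin_numE//; have /andP[_ /le_lt_trans] := fas x; apply.
  by rewrite ltry.
pose h x := f x - a%:E; pose k x := s%:E - h x.
have h0 x : 0 <= h x by rewrite /h sube_ge0//; have /andP[] := fas x.
have hfin x : h x \is a fin_num by rewrite fin_numB ffin.
have k0 x : 0 <= k x.
  by rewrite /k sube_ge0 ?hfin// /h leeBlDr// -EFinD addrC; have /andP[] := fas x.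
have mh : measurable_fun setT h by exact: emeasurable_funB.
have mk : measurable_fun setT k by exact: emeasurable_funB.
have total (m : {measure set T -> \bar R}) :
    \int[m]_x h x + \int[m]_x k x = s%:E * m setT.
  rewrite -ge0_integralD// -integral_cst//; apply: eq_integral => x _.
  by rewrite /k addeC subeK.
have fE (x : T) : iter 2 (markov_op P) f x = a%:E + \int[kernel_pow P 2 x]_y h y.
  rewrite -integral_kernel_pow//; transitivity (\int[kernel_pow P 2 x]_y (cst a%:E y + h y)).
    by apply: eq_integral => y _; rewrite /h addeC subeK.
  by rewrite ge0_integralD// integral_cst// prob_kernel mule1.
have nuh0 : 0 <= \int[nu]_x h x by exact: integral_ge0.
have nuk0 : 0 <= \int[nu]_x k x by exact: integral_ge0.
have nutot := total nu; rewrite nuT -EFinM in nutot.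
have nuhfin : \int[nu]_x h x \is a fin_num.
  rewrite ge0_fin_numE// (@le_lt_trans _ _ (s * alpha)%:E) ?ltry//.
  by rewrite -nutot leeDl.
have nukfin : \int[nu]_x k x \is a fin_num.
  rewrite ge0_fin_numE// (@le_lt_trans _ _ (s * alpha)%:E) ?ltry//.
  by rewrite -nutot leeDr.
exists (a + fine (\int[nu]_x h x))%R; first by rewrite addr_ge0// fine_ge0.
move=> x; rewrite fE.
have Qtot := total (kernel_pow P 2 x).
have Qh : \int[nu]_x h x <= \int[kernel_pow P 2 x]_y h y.
  by apply: ge0_le_measure_integral => // A; exact: nuP.
have Qk : \int[nu]_x k x <= \int[kernel_pow P 2 x]_y k y.
  by apply: ge0_le_measure_integral => // A; exact: nuP.
rewrite prob_kernel mule1 in Qtot.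
have Qh0 : 0 <= \int[kernel_pow P 2 x]_y h y by exact: integral_ge0.
have Qk0 : 0 <= \int[kernel_pow P 2 x]_y k y by exact: integral_ge0.
have Qhfin : \int[kernel_pow P 2 x]_y h y \is a fin_num.
  by rewrite ge0_fin_numE// (@le_lt_trans _ _ s%:E) ?ltry// -Qtot leeDl.
have Qkfin : \int[kernel_pow P 2 x]_y k y \is a fin_num.
  by rewrite ge0_fin_numE// (@le_lt_trans _ _ s%:E) ?ltry// -Qtot leeDr.
move: nutot Qtot Qh Qk.
rewrite -(fineK nuhfin) -(fineK nukfin) -(fineK Qhfin) -(fineK Qkfin) /=.
rewrite -!EFinD !lee_fin => -[nutot] [Qtot] Qh Qk.
rewrite lerD2l Qh/= -addrA lerD2l; lra.
Qed.

Lemma doeblin_contraction t (f : T -> \bar R) (s : R) :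
  (0 <= s)%R -> measurable_fun setT f ->
  (forall x, 0 <= f x <= s%:E) ->
  exists2 c : R, (0 <= c)%R & forall x,
    c%:E <= iter (2 * t) (markov_op P) f x <= (c + (1 - alpha) ^+ t * s)%:E.
Proof.
move=> s0 mf fs; have f0 x : 0 <= f x by have /andP[] := fs x.
elim: t => [|t [c c0 IH]].
  by exists 0%R => // x; rewrite muln0 expr0 mul1r add0r.
rewrite mulnS add2n exprS -mulrA.
apply: (@doeblin_step _ c) => //; last exact: measurable_iter_markov_op.
have /andP[_ a1] := alpha01.
by rewrite mulr_ge0// exprn_ge0// subr_ge0.
Qed.

Variable pi : probability T R.
Hypothesis inv : forall f : T -> \bar R, (forall x, 0 <= f x) ->
  measurable_fun setT f -> \int[pi]_x markov_op P f x = \int[pi]_x f x.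

Lemma integral_iter_markov_op n (f : T -> \bar R) : (forall x, 0 <= f x) ->
  measurable_fun setT f -> \int[pi]_x iter n (markov_op P) f x = \int[pi]_x f x.
Proof.
move=> f0 mf; elim: n => [//|n IH] /=; rewrite inv//; first exact: iter_markov_op_ge0.
exact: measurable_iter_markov_op.
Qed.

Lemma integral_between (m : probability T R) (f : T -> \bar R) (a b : R) :
  (0 <= a)%R -> measurable_fun setT f -> (forall x, a%:E <= f x <= b%:E) ->
  a%:E <= \int[m]_x f x <= b%:E.
Proof.
move=> a0 mf fab.
have f0 x : 0 <= f x.
  by have /andP[+ _] := fab x; apply: le_trans; rewrite lee_fin.
have E (r : R) : r%:E = \int[m]__ r%:E.
  by rewrite integral_cst// -[LHS]mule1; congr (_ * _); exact/esym/probability_setT.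
rewrite [a%:E in X in X && _]E [b%:E]E; apply/andP; split.
  by apply: ge0_le_integral => // x _; have /andP[] := fab x.
by apply: ge0_le_integral => // x _; have /andP[] := fab x.
Qed.

(** By invariance the pi-mean of f is the pi-mean of its image under 2 t steps, so
it lies in the interval that contains every value of this image. *)
Lemma doeblin_dist t x (f : T -> \bar R) (s : R) :
  (0 <= s)%R -> measurable_fun setT f -> (forall x, 0 <= f x <= s%:E) ->
  `| iter (2 * t) (markov_op P) f x - \int[pi]_y f y | <= ((1 - alpha) ^+ t * s)%:E.
Proof.
move=> s0 mf fs; have f0 y : 0 <= f y by have /andP[] := fs y.
have [c c0 cP] := doeblin_contraction t s0 mf fs.
have := integral_between pi c0 (measurable_iter_markov_op P (2 * t) f0 mf) cP.
rewrite integral_iter_markov_op//; have := cP x.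
move: (iter _ _ _ _) => u; move: (\int[pi]_y f y) => v.
move: u v => [u| |] [v| |] //=; rewrite ?leye_eq ?leeNy_eq ?andbF ?lee_fin//.
move=> /andP[cu uc] /andP[cv vc]; rewrite ler_norml; apply/andP; split; lra.
Qed.

End doeblin.

Section drift_and_minorization.
Local Open Scope ereal_scope.
Context d (T : measurableType d) (R : realType) (P : R.-pker T ~> T).
Variables (nu : {measure set T -> \bar R}) (alpha : R) (pi : probability T R).
Variables (V : T -> R) (K : R).
Hypothesis alpha01 : (0 < alpha < 1)%R.
Hypothesis nuT : nu setT = alpha%:E.
Hypothesis nuP : forall x A, measurable A -> nu A <= kernel_pow P 2 x A.
Hypothesis inv : forall f : T -> \bar R, (forall x, 0 <= f x) ->
  measurable_fun setT f -> \int[pi]_x markov_op P f x = \int[pi]_x f x.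
Hypothesis mV : measurable_fun setT V.
Hypothesis V0 : forall x, (0 <= V x)%R.
Hypothesis K0 : (0 < K)%R.
Hypothesis drift : forall x, \int[P x]_y (V y)%:E <= K%:E.

Let alphaW : (0 <= alpha <= 1)%R.
Proof. by have /andP[a0 a1] := alpha01; rewrite !ltW. Qed.

(** The positive and negative parts are bounded together: their sum is |f|. *)
Lemma drift_markov_op (f : T -> R) x : measurable_fun setT f ->
  (forall y, `|f y| <= 1 + V y)%R ->
  markov_op P (EFin \o f)^\+ x + markov_op P (EFin \o f)^\- x <= (1 + K)%:E.
Proof.
move=> mf fV; have mEf : measurable_fun setT (EFin \o f) by exact/measurable_EFinP.
rewrite /markov_op -ge0_integralD//; last 2 first.
  exact: measurable_funepos.
  exact: measurable_funeneg.
apply: (@le_trans _ _ (\int[P x]_y (cst 1%:E y + (V y)%:E))).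
  apply: ge0_le_integral => //.
  - by move=> y _; exact: adde_ge0.
  - by apply: emeasurable_funD; [exact: measurable_funepos|exact: measurable_funeneg].
  - by apply: emeasurable_funD => //; exact/measurable_EFinP.
  - by move=> y _; rewrite -[leLHS]/(((EFin \o f)^\+ \+ (EFin \o f)^\-) y) -fune_abse lee_fin.
rewrite ge0_integralD//; last 2 first.
  by move=> y _; rewrite lee_fin.
  exact/measurable_EFinP.
by rewrite integral_cst// prob_kernel mule1 EFinD leeD2l.
Qed.

(** The first of the 2 t + 1 steps replaces f by a function bounded by 1 + K;
the remaining steps contract its oscillation, at most 2 (1 + K). *)
Lemma weighted_doeblin_dist t x (f : T -> R) : measurable_fun setT f ->
  (forall y, `|f y| <= 1 + V y)%R ->
  `| \int[kernel_pow P (2 * t + 1) x]_y (f y)%:E - \int[pi]_y (f y)%:E |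
    <= (2 * (1 + K) * (1 - alpha) ^+ t)%:E.
Proof.
move=> mf fV; have mEf : measurable_fun setT (EFin \o f) by exact/measurable_EFinP.
have mfp := measurable_funepos mEf; have mfn := measurable_funeneg mEf.
rewrite integralE [in X in _ - X]integralE.
rewrite !integral_kernel_pow// -!(inv _ mfp, inv _ mfn)//.
rewrite addn1 !iterSr.
set gp := markov_op P (EFin \o f)^\+; set gn := markov_op P (EFin \o f)^\-.
set b := (1 + K)%R.
have gb y : gp y + gn y <= b%:E by exact: drift_markov_op.
have gp0 y : 0 <= gp y by exact: markov_op_ge0.
have gn0 y : 0 <= gn y by exact: markov_op_ge0.
have gnb y : gn y <= b%:E by apply: le_trans (gb y); rewrite leeDr.
have gpb y : gp y <= b%:E by apply: le_trans (gb y); rewrite leeDl.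
have mgp : measurable_fun setT gp by exact: measurable_markov_op.
have mgn : measurable_fun setT gn by exact: measurable_markov_op.
have gnfin y : gn y \is a fin_num.
  by rewrite ge0_fin_numE// (le_lt_trans (gnb y))// ltry.
pose k y := b%:E - gn y.
have k0 y : 0 <= k y by rewrite sube_ge0 ?gnfin.
have mk : measurable_fun setT k by exact: emeasurable_funB.
pose h y := gp y + k y.
have h0 y : 0 <= h y by exact: adde_ge0.
have mh : measurable_fun setT h by exact: emeasurable_funD.
have hb y : h y <= (2 * b)%:E.
  rewrite mulr_natl mulr2n EFinD leeD//.
  by rewrite leeBlDr// leeDl.
have b0 : (0 <= 2 * b)%R by rewrite mulr_ge0// addr_ge0// ltW.
(* shifting by b turns the signed difference into one nonnegative function *)
have shift (m : {measure set T -> \bar R}) : m setT = 1 ->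
    \int[m]_y gp y - \int[m]_y gn y = \int[m]_y h y - b%:E.
  move=> mT.
  have kE : \int[m]_y k y + \int[m]_y gn y = b%:E.
    rewrite -ge0_integralD// -[RHS]mule1 -mT -integral_cst//.
    by apply: eq_integral => y _; rewrite subeK.
  have gn0' : 0 <= \int[m]_y gn y by exact: integral_ge0.
  have k0' : 0 <= \int[m]_y k y by exact: integral_ge0.
  have gnf : \int[m]_y gn y \is a fin_num.
    by rewrite ge0_fin_numE// (@le_lt_trans _ _ b%:E) ?ltry// -kE leeDr.
  have kf : \int[m]_y k y \is a fin_num.
    by rewrite ge0_fin_numE// (@le_lt_trans _ _ b%:E) ?ltry// -kE leeDl.
  have -> : \int[m]_y h y = \int[m]_y gp y + \int[m]_y k y by rewrite -ge0_integralD.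
  move: kE gnf kf.
  move: (\int[m]_y gp y) (\int[m]_y k y) (\int[m]_y gn y) => p q r <- rfin qfin.
  by rewrite oppeD ?fin_num_adde_defr// addeA addeK.
rewrite -!integral_kernel_pow//.
have piT : pi setT = 1 by exact: probability_setT.
have kT : kernel_pow P (2 * t) x setT = 1 by exact: prob_kernel.
rewrite (shift _ piT) (shift _ kT).
have subB (u v : \bar R) : u - b%:E - (v - b%:E) = u - v.
  by rewrite oppeB ?fin_num_adde_defl// addeACA [- _ + _]addeC subee// adde0.
rewrite subB integral_kernel_pow//.
rewrite [(_ * (1 - _) ^+ t)%R]mulrC.
by apply: (doeblin_dist alphaW nuT nuP inv) => // y; rewrite h0 hb.
Qed.

(** Agreement on measurable sets is all that can be asked of set functions that
are defined by integrals. *)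
Theorem hyper_uniformly_ergodic_drift_minorization
    (P0 : T -> set T -> \bar R) (pi0 : set T -> \bar R) :
  (forall x A, measurable A -> P0 x A = P x A) ->
  (forall A, measurable A -> pi0 A = pi A) ->
  hyper_uniformly_ergodic V P0 pi0.
Proof.
move=> PE piE; exists alpha, K; split=> // x t _.
have E n f : \int[kernel_iter P0 n x]_y f y = \int[kernel_pow P n x]_y f y.
  by apply: eq_set_function_integral => A; exact: kernel_iterE.
have piE' f : \int[pi0]_y f y = \int[pi]_y f y by exact: eq_set_function_integral.
split; apply: ge_ereal_sup => _ [f [mf fb] <-]; rewrite E piE'.
  have mEf : measurable_fun setT (EFin \o f) by exact/measurable_EFinP.
  have f0 y : 0 <= (f y)%:E by rewrite lee_fin; have /andP[] := fb y.
  rewrite integral_kernel_pow// -[leRHS]mule1 -EFinM.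
  by apply: (doeblin_dist alphaW nuT nuP inv).
exact: weighted_doeblin_dist.
Qed.

End drift_and_minorization.

(** * Quadratic forms of positive definite matrices *)

Section measurable_matrix.
Context {R : realType} d (T : measurableType d).

Lemma measurable_mx_coef m n (f : T -> 'M[R]_(m, n)) i j :
  measurable_fun setT f -> measurable_fun setT (fun t => f t i j).
Proof. by move=> mf; apply: (measurableT_comp (measurable_mx_entry i j)). Qed.

Lemma measurable_addmx m n (f g : T -> 'M[R]_(m, n)) :
  measurable_fun setT f -> measurable_fun setT g ->
  measurable_fun setT (fun t => f t + g t).
Proof.
move=> mf mg; apply: measurable_mxP => i j; under eq_fun do rewrite mxE.
by apply: measurable_funD; exact: measurable_mx_coef.
Qed.

Lemma measurable_trmx m n (f : T -> 'M[R]_(m, n)) :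
  measurable_fun setT f -> measurable_fun setT (fun t => (f t)^T).
Proof.
move=> mf; apply: measurable_mxP => i j; under eq_fun do rewrite mxE.
exact: measurable_mx_coef.
Qed.

Lemma measurable_mulmx m n p (f : T -> 'M[R]_(m, n)) (g : T -> 'M[R]_(n, p)) :
  measurable_fun setT f -> measurable_fun setT g ->
  measurable_fun setT (fun t => f t *m g t).
Proof.
move=> mf mg; apply: measurable_mxP => i j; under eq_fun do rewrite mxE.
apply: measurable_sum => k.
by apply: measurable_funM; exact: measurable_mx_coef.
Qed.

Lemma measurable_dotv p (f g : T -> 'cV[R]_p) :
  measurable_fun setT f -> measurable_fun setT g ->
  measurable_fun setT (fun t => dotv (f t) (g t)).
Proof.
move=> mf mg; apply: measurable_mx_coef; apply: measurable_mulmx => //.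
exact: measurable_trmx.
Qed.

Lemma measurable_qform p (A : T -> 'M[R]_p) (f : T -> 'cV[R]_p) :
  measurable_fun setT A -> measurable_fun setT f ->
  measurable_fun setT (fun t => qform (A t) (f t)).
Proof.
move=> mA mf; apply: measurable_mx_coef; apply: measurable_mulmx => //.
by apply: measurable_mulmx => //; exact: measurable_trmx.
Qed.

End measurable_matrix.

Section quadratic_forms.
Context {R : realType}.

Lemma dotvE n (x y : 'cV[R]_n) : dotv x y = \sum_i x i ord0 * y i ord0.
Proof. by rewrite /dotv mxE; apply: eq_bigr => i _; rewrite mxE. Qed.

Lemma dotvC n (x y : 'cV[R]_n) : dotv x y = dotv y x.
Proof. by rewrite !dotvE; apply: eq_bigr => i _; rewrite mulrC. Qed.

Lemma dotvv n (x : 'cV[R]_n) : dotv x x = enorm x ^+ 2.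
Proof.
rewrite /enorm sqr_sqrtr ?dotvE; first by apply: eq_bigr => i _; rewrite expr2.
by apply: sumr_ge0 => i _; exact: sqr_ge0.
Qed.

Lemma qformE n (A : 'M[R]_n) x : qform A x = dotv x (A *m x).
Proof. by rewrite /qform /dotv mulmxA. Qed.

Lemma dotvDr n (x y z : 'cV[R]_n) : dotv x (y + z) = dotv x y + dotv x z.
Proof. by rewrite /dotv mulmxDr mxE. Qed.

Lemma dotvNr n (x y : 'cV[R]_n) : dotv x (- y) = - dotv x y.
Proof. by rewrite /dotv mulmxN mxE. Qed.

Lemma dotvZr n c (x y : 'cV[R]_n) : dotv x (c *: y) = c * dotv x y.
Proof. by rewrite /dotv -scalemxAr mxE. Qed.

Lemma dotvDl n (x y z : 'cV[R]_n) : dotv (x + y) z = dotv x z + dotv y z.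
Proof. by rewrite dotvC dotvDr !(dotvC z). Qed.

Lemma dotvNl n (x y : 'cV[R]_n) : dotv (- x) y = - dotv x y.
Proof. by rewrite dotvC dotvNr dotvC. Qed.

Lemma dotvZl n c (x y : 'cV[R]_n) : dotv (c *: x) y = c * dotv x y.
Proof. by rewrite dotvC dotvZr dotvC. Qed.

Lemma dotv_mulmx n (A : 'M[R]_n) x y : A^T = A -> dotv x (A *m y) = dotv y (A *m x).
Proof.
by move=> sA; rewrite [in RHS]dotvC /dotv trmx_mul sA mulmxA.
Qed.

Lemma qformD n (A : 'M[R]_n) x y : A^T = A ->
  qform A (x + y) = qform A x + 2 * dotv x (A *m y) + qform A y.
Proof.
move=> sA; rewrite !qformE mulmxDr !dotvDl !dotvDr (dotv_mulmx y x sA); ring.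
Qed.

Lemma qformZ n (A : 'M[R]_n) c x : qform A (c *: x) = c ^+ 2 * qform A x.
Proof. by rewrite !qformE -scalemxAr dotvZl dotvZr mulrA. Qed.

Lemma qformN n (A : 'M[R]_n) x : qform A (- x) = qform A x.
Proof. by rewrite !qformE mulmxN dotvNl dotvNr opprK. Qed.

Lemma qform_addm n (A B : 'M[R]_n) x : qform (A + B) x = qform A x + qform B x.
Proof. by rewrite !qformE mulmxDl dotvDr. Qed.

Lemma qform_scalem n (A : 'M[R]_n) c x : qform (c *: A) x = c * qform A x.
Proof. by rewrite !qformE -scalemxAl dotvZr. Qed.

Lemma sym_posdef_ge0 n (A : 'M[R]_n) x : sym_posdef A -> 0 <= qform A x.
Proof.
move=> [_ A0]; have [->|x0] := eqVneq x 0; last exact/ltW/A0.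
by rewrite /qform mulmx0 mxE.
Qed.

(** The Schur complement of the top left entry. *)
Definition schur n (A : 'M[R]_n.+1) : 'M[R]_n :=
  let b := dlsubmx (A : 'M[R]_(1 + n)) in
  drsubmx (A : 'M[R]_(1 + n)) - (A ord0 ord0)^-1 *: (b *m b^T).

Lemma sym_block n (A : 'M[R]_n.+1) : A^T = A -> A =
  block_mx (A ord0 ord0)%:M (dlsubmx (A : 'M[R]_(1 + n)))^T
    (dlsubmx (A : 'M[R]_(1 + n))) (drsubmx (A : 'M[R]_(1 + n))) :> 'M[R]_(1 + n).
Proof.
move=> sA; rewrite -[LHS](@submxK _ 1 n 1 n); congr block_mx.
  rewrite [LHS]mx11_scalar; congr (_%:M); rewrite !mxE; congr (A _ _); exact: val_inj.
by rewrite trmx_dlsub; congr ursubmx; rewrite sA.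
Qed.

Lemma dotv_cons n (z z' : R * 'cV[R]_n) :
  dotv (cV_cons z) (cV_cons z') = z.1 * z'.1 + dotv z.2 z'.2.
Proof.
rewrite !dotvE big_ord_recl !cV_cons0; congr (_ + _).
by apply: eq_bigr => i _; rewrite !cV_consS.
Qed.

Lemma mulmx_cons n (A : 'M[R]_n.+1) z (b := dlsubmx (A : 'M[R]_(1 + n))) :
  A^T = A -> A *m cV_cons z =
  cV_cons (A ord0 ord0 * z.1 + dotv b z.2,
           z.1 *: b + drsubmx (A : 'M[R]_(1 + n)) *m z.2).
Proof.
move=> sA; rewrite /cV_cons {1}(sym_block sA) (@mul_block_col _ 1 n 1 n) /=.
congr (@col_mx _ 1 n 1); last by rewrite mul_mx_scalar.
by rewrite [b^T *m _]mx11_scalar -/(dotv b z.2) -scalar_mxM raddfD.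
Qed.

(** Completion of the square in the first coordinate. *)
Lemma qform_cons n (A : 'M[R]_n.+1) z : A^T = A -> A ord0 ord0 != 0 ->
  qform A (cV_cons z) = A ord0 ord0 *
    (z.1 + (A ord0 ord0)^-1 * dotv (dlsubmx (A : 'M[R]_(1 + n))) z.2) ^+ 2
    + qform (schur A) z.2.
Proof.
move=> sA a0; rewrite qformE mulmx_cons// dotv_cons /=.
set b := dlsubmx _; set a := A ord0 ord0.
have -> : qform (schur A) z.2 =
    dotv z.2 (drsubmx (A : 'M[R]_(1 + n)) *m z.2) - a^-1 * dotv b z.2 ^+ 2.
  rewrite /schur -/b -/a -scaleNr qform_addm qform_scalem mulNr qformE.
  congr (_ - _ * _).
  by rewrite qformE -mulmxA [b^T *m _]mx11_scalar -/(dotv b z.2) mul_mx_scalar dotvZr dotvC.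
rewrite dotvDr dotvZr (dotvC z.2 b); field.
exact: a0.
Qed.

Lemma posdef_corner n (A : 'M[R]_n.+1) : sym_posdef A -> 0 < A ord0 ord0.
Proof.
move=> [sA A0]; have /A0 : cV_cons (1, 0) != 0 :> 'cV[R]_n.+1.
  apply/eqP => /matrixP/(_ ord0 ord0); rewrite cV_cons0 mxE /= => /eqP.
  by rewrite oner_eq0.
rewrite qformE mulmx_cons// dotv_cons /= !mulr1 mul1r.
by rewrite mulmx0 addr0 /dotv mulmx0 trmx0 mul0mx !mxE !addr0.
Qed.

(** For a given y, the first coordinate can be chosen to make the square in
qform_cons vanish. *)
Lemma posdef_schur n (A : 'M[R]_n.+1) : sym_posdef A -> sym_posdef (schur A).
Proof.
move=> pA; have a0 := posdef_corner pA; have [sA A0] := pA; split.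
  by rewrite /schur linearB linearZ /= trmx_mul trmxK trmx_drsub sA.
move=> y y0.
pose x0 := - ((A ord0 ord0)^-1 * dotv (dlsubmx (A : 'M[R]_(1 + n))) y).
have /A0 : cV_cons (x0, y) != 0.
  apply: contraNneq y0 => /matrixP e0; apply/eqP/matrixP => i j.
  by rewrite [j]ord1; have := e0 (lift ord0 i) ord0; rewrite cV_consS mxE => -> /[!mxE].
by rewrite qform_cons ?gt_eqF//= addNr expr0n mulr0 add0r.
Qed.

(** One step of Gaussian elimination. *)
Lemma det_schur n (A : 'M[R]_n.+1) : A^T = A -> A ord0 ord0 != 0 ->
  \det A = A ord0 ord0 * \det (schur A).
Proof.
move=> sA a0; set a := A ord0 ord0; set b := dlsubmx (A : 'M[R]_(1 + n)).
have {1}-> : A = block_mx 1%:M 0 (a^-1 *: b) 1%:M *m block_mx a%:M b^T 0 (schur A)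
    :> 'M[R]_(1 + n).
  rewrite mulmx_block !mul1mx !mul0mx !addr0 {1}(sym_block sA) -/a -/b.
  congr block_mx; first by rewrite mul_mx_scalar scalerA divff// scale1r.
  by rewrite /schur -/a -/b -scalemxAl addrC subrK.
rewrite det_mulmx (@det_lblock _ 1 n) (@det_ublock _ 1 n) !det1 !mul1r.
by rewrite det_scalar1.
Qed.

Lemma posdef_det_gt0 n (A : 'M[R]_n) : sym_posdef A -> 0 < \det A.
Proof.
elim: n A => [A _|n IH A pA]; first by rewrite det_mx00.
have a0 := posdef_corner pA; have [sA _] := pA.
by rewrite det_schur ?gt_eqF// mulr_gt0// IH//; exact: posdef_schur.
Qed.

Lemma posdef_unitmx n (A : 'M[R]_n) : sym_posdef A -> A \in unitmx.
Proof. by move=> pA; rewrite unitmxE unitfE gt_eqF// posdef_det_gt0. Qed.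

Lemma posdef_invmx n (A : 'M[R]_n) : sym_posdef A -> sym_posdef (invmx A).
Proof.
move=> pA; have uA := posdef_unitmx pA; have [sA A0] := pA; split.
  by rewrite trmx_inv sA.
move=> x x0; have /A0 : invmx A *m x != 0.
  by apply: contraNneq x0 => e; rewrite -(mulKVmx uA x) e mulmx0.
by rewrite qformE mulKVmx// dotvC -qformE.
Qed.

Lemma posdefD n (A B : 'M[R]_n) : sym_possemidef A -> sym_posdef B ->
  sym_posdef (A + B).
Proof.
move=> [sA A0] [sB B0]; split; first by rewrite linearD /= sA sB.
by move=> x x0; rewrite qform_addm ltr_wpDl ?A0// B0.
Qed.

Lemma posdefZ n c (A : 'M[R]_n) : 0 < c -> sym_posdef A -> sym_posdef (c *: A).
Proof.
move=> c0 [sA A0]; split; first by rewrite linearZ /= sA.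
by move=> x x0; rewrite qform_scalem mulr_gt0// A0.
Qed.

(** The form A is nonnegative at y - (b / c) A^-1 v, where b = v.y and
c = v^T A^-1 v. *)
Lemma posdef_cauchy_schwarz n (A : 'M[R]_n) v y : sym_posdef A ->
  dotv v y ^+ 2 <= qform (invmx A) v * qform A y.
Proof.
move=> pA; have uA := posdef_unitmx pA; have [sA A0] := pA.
have [->|v0] := eqVneq v 0.
  by rewrite dotvC /dotv /qform !mulmx0 mxE expr0n mul0r.
have [_ /(_ _ v0) c0] := posdef_invmx pA.
set c := qform _ v in c0 *; set b := dotv v y.
have : 0 <= qform A (y + - (b / c) *: (invmx A *m v)) by exact: sym_posdef_ge0.
have -> : qform A (y + - (b / c) *: (invmx A *m v)) = qform A y - b ^+ 2 / c.
  rewrite qformD// qformZ (qformE A (invmx A *m v)) -scalemxAr mulKVmx// dotvZr.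
  rewrite (dotvC y) -/b (dotvC _ v) -qformE -/c; field; exact: lt0r_neq0.
by rewrite subr_ge0 ler_pdivrMr// mulrC.
Qed.

(** Cauchy-Schwarz against each basis vector. The trace serves as an upper bound
for the largest eigenvalue of S. *)
Lemma enorm_sqr_le n (S : 'M[R]_n) y : sym_posdef S ->
  enorm y ^+ 2 <= \tr S * qform (invmx S) y.
Proof.
move=> pS; rewrite -dotvv dotvE /mxtrace mulr_suml; apply: ler_sum => i _.
have := posdef_cauchy_schwarz (delta_mx i ord0) y (posdef_invmx pS).
rewrite invmxK; have -> : dotv (delta_mx i ord0) y = y i ord0.
  by rewrite /dotv trmx_delta -rowE mxE.
have -> : qform S (delta_mx i ord0) = S i i.
  by rewrite /qform trmx_delta -rowE -colE !mxE.
by rewrite expr2.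
Qed.

End quadratic_forms.

Section bounds.
Context {R : realType}.

Lemma coord_le_enorm p (x : 'cV[R]_p) i : x i ord0 ^+ 2 <= enorm x ^+ 2.
Proof.
rewrite -dotvv dotvE (bigD1 i)//= expr2 lerDl sumr_ge0// => j _.
by rewrite -expr2 sqr_ge0.
Qed.

Lemma trmx_continuous m n : continuous (@trmx R m n).
Proof.
move=> v A /nbhs_ballP[e /= e0 eA].
apply: (@filterS _ _ (nbhs_filter v) (ball v e)); last exact: nbhsx_ballx.
by move=> w [_ vw]; apply: eA; split=> // i j; rewrite !mxE; exact: vw.
Qed.

(** The ball lies in a box, which is compact as a product of segments. *)
Lemma continuous_bounded_ball p (h : 'cV[R]_p -> R) (rho : R) : continuous h ->
  exists B : R, forall x, enorm x ^+ 2 <= rho -> `|h x| <= B.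
Proof.
move=> ch.
pose K := [set v : 'rV[R]_p | forall i, `[(- (rho + 1)), rho + 1]%classic (v ord0 i)].
have cK : compact K.
  apply: (@rV_compact _ _ (fun=> `[(- (rho + 1)), rho + 1]%classic)) => i.
  exact: segment_compact.
have cht : continuous (h \o @trmx R 1 p).
  by move=> v; apply: continuous_comp; [exact: trmx_continuous|exact: ch].
have /compact_bounded[M [_ Mb]] := continuous_compact (continuous_subspaceT cht) cK.
exists (M + 1) => x xr; apply: (Mb (M + 1)); first by rewrite ltrDl.
exists x^T; last by rewrite /= trmxK.
move=> i; rewrite /= mxE in_itv /= -ler_norml.
(* t^2 <= rho forces |t| <= rho + 1 *)
have := le_trans (coord_le_enorm x i) xr; rewrite -real_normK ?num_real// => h1.
have := normr_ge0 (x i ord0); nra.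
Qed.

(** The entrywise bound is crude, but it is visibly measurable in A. *)
Lemma qform_le p (A : 'M[R]_p) x :
  qform A x <= (\sum_i \sum_j `|A i j|) * enorm x ^+ 2.
Proof.
rewrite qformE dotvE mulr_suml; apply: ler_sum => i _.
rewrite mxE mulr_sumr mulr_suml; apply: ler_sum => j _.
have xi := coord_le_enorm x i; have xj := coord_le_enorm x j.
rewrite mulrCA; apply: (le_trans (ler_norm _)); rewrite normrM ler_wpM2l//.
rewrite ler_norml; nra.
Qed.

Lemma measurable_enorm_sqr p : measurable_fun setT (fun x : 'cV[R]_p => enorm x ^+ 2).
Proof.
by under eq_fun do rewrite -dotvv; apply: measurable_dotv; exact: measurable_id.
Qed.

Lemma measurable_enorm_ball p (c : R) :
  measurable [set x : 'cV[R]_p | enorm x ^+ 2 <= c].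
Proof.
have := @measurable_enorm_sqr p measurableT _ (measurable_itv `]-oo, c]).
rewrite setTI; congr (measurable _).
Qed.

End bounds.

(** * Gaussian integrals *)

Section gaussian_integral.
Context {R : realType}.

(** The normal density of variance 1 / a has mass one. *)
Lemma integral_gauss1 (a c : R) : 0 < a ->
  (\int[lebesgue_measure]_x (expR (- (2^-1 * (a * (x + c) ^+ 2))))%:E =
  (Num.sqrt (2 * pi / a))%:E)%E.
Proof.
move=> a0; pose s := Num.sqrt a^-1.
have s0 : s != 0 by rewrite gt_eqF// sqrtr_gt0 invr_gt0.
have s2 : s ^+ 2 = a^-1 by rewrite sqr_sqrtr// invr_ge0 ltW.
have k0 : 0 < normal_peak s by exact: normal_peak_gt0.
transitivity ((normal_peak s)^-1%:E * \int[lebesgue_measure]_x (normal_pdf (- c) s x)%:E)%E.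
  rewrite -ge0_integralZl//=; last 3 first.
  - by apply/measurable_EFinP; exact: measurable_normal_pdf.
  - by move=> x _; rewrite lee_fin normal_pdf_ge0.
  - by rewrite lee_fin invr_ge0 ltW.
  apply: eq_integral => x _; rewrite -EFinM normal_pdfE// mulKf ?gt_eqF//.
  rewrite /normal_fun s2 opprK; congr (expR _)%:E; field; exact: lt0r_neq0.
rewrite integral_normal_pdf mule1 /normal_peak invrK s2; congr (Num.sqrt _)%:E.
by field; exact: lt0r_neq0.
Qed.

Lemma measurable_expR_qform d (T : measurableType d) n (A : T -> 'M[R]_n)
    (f : T -> 'cV[R]_n) : measurable_fun setT A -> measurable_fun setT f ->
  measurable_fun setT (fun t => expR (- (2^-1 * qform (A t) (f t)))).
Proof.
move=> mA mf; apply: measurableT_comp => //; apply: measurableT_comp => //.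
by apply: measurable_funM => //; exact: measurable_qform.
Qed.

(** Tonelli, with the first coordinate integrated innermost. *)
Lemma ge0_integral_cV_cons n (f : 'cV[R]_n.+1 -> \bar R) :
  (forall x, 0 <= f x)%E -> measurable_fun setT f ->
  (\int[lebesgue_cV n.+1]_x f x =
   \int[lebesgue_cV n]_y \int[lebesgue_measure]_x f (cV_cons (x, y)))%E.
Proof.
move=> f0 mf.
pose RT := (measurableTypeR R * 'cV[R]_n)%type.
have mc : measurable_fun (setT : set RT) (@cV_cons R n : RT -> 'cV[R]_n.+1).
  exact: measurable_cV_cons.
have mfc : measurable_fun (setT : set RT) (f \o (@cV_cons R n : RT -> 'cV[R]_n.+1)).
  by apply: measurableT_comp.
transitivity (\int[@pushforward _ _ RT _ R (@lebesgue_measure R \x lebesgue_cV n)%E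
    (@cV_cons R n)]_x f x)%E.
  by apply: eq_set_function_integral => A _.
rewrite (@ge0_integral_pushforward _ _ RT _ R _ mc
  (@lebesgue_measure R \x lebesgue_cV n)%E setT f measurableT mf (fun x _ => f0 x)).
rewrite preimage_setT.
exact: (@fubini_tonelli2 _ _ (measurableTypeR R) 'cV[R]_n R lebesgue_measure (lebesgue_cV n)
  (f \o @cV_cons R n) mfc (fun z => f0 _)).
Qed.

Lemma cV_consB n (z z' : R * 'cV[R]_n) :
  cV_cons z - cV_cons z' = cV_cons (z.1 - z'.1, z.2 - z'.2).
Proof.
by rewrite /cV_cons (@opp_col_mx _ 1 n) (@add_col_mx _ 1 n) /= raddfB.
Qed.

(** The first coordinate is integrated out by completing the square; what remains
is the Gaussian of the Schur complement, whose determinant is that of A divided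
by the top left entry. *)
Lemma integral_gauss n (A : 'M[R]_n) m : sym_posdef A ->
  (\int[lebesgue_cV n]_x (expR (- (2^-1 * qform A (x - m))))%:E =
   (Num.sqrt ((2 * pi) ^+ n / \det A))%:E)%E.
Proof.
elim: n A m => [A m _|n IH A m pA].
  rewrite /= integral_dirac//; last first.
    apply/measurable_EFinP; apply: measurable_expR_qform => //.
    apply: measurable_addmx => //; exact: measurable_id.
  rewrite diracT mul1e det_mx00 expr0 divr1 sqrtr1 /qform.
  by rewrite (flatmx0 (0 - m)) mulmx0 mxE mulr0 oppr0 expR0.
have a0 := posdef_corner pA; have [sA _] := pA.
have an0 : A ord0 ord0 != 0 by rewrite gt_eqF.
have pS := posdef_schur pA; have dS := posdef_det_gt0 pS.
rewrite -(cV_unconsK m); move: (cV_uncons m) => [m0 m'].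
rewrite ge0_integral_cV_cons; last 2 first.
  - by move=> x; rewrite lee_fin expR_ge0.
  - apply/measurable_EFinP; apply: measurable_expR_qform => //.
    apply: measurable_addmx => //; exact: measurable_id.
transitivity (\int[lebesgue_cV n]_y ((Num.sqrt (2 * pi / A ord0 ord0))%:E *
    (expR (- (2^-1 * qform (schur A) (y - m'))))%:E))%E.
  apply: eq_integral => y _.
  rewrite muleC -(integral_gauss1 (- m0 + (A ord0 ord0)^-1 *
    dotv (dlsubmx (A : 'M[R]_(1 + n))) (y - m')) a0).
  rewrite -ge0_integralZl//=; last first.
    apply/measurable_EFinP; apply: measurableT_comp => //.
    apply: measurableT_comp => //; apply: measurable_funM => //.
    apply: measurable_funM => //; apply: measurable_funX.
    exact: measurable_funD.
  apply: eq_integral => x _.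
  rewrite -EFinM -expRD cV_consB qform_cons//= addrA; congr (expR _)%:E; ring.
rewrite ge0_integralZl//=; last first.
  apply/measurable_EFinP; apply: measurable_expR_qform => //.
  apply: measurable_addmx => //; exact: measurable_id.
rewrite IH// -EFinM -sqrtrM; last by rewrite divr_ge0 ?mulr_ge0 ?pi_ge0 // ltW.
rewrite det_schur// exprS; congr (Num.sqrt _)%:E; field.
by rewrite an0 gt_eqF.
Qed.

End gaussian_integral.

Section multinormal_moments.
Context {R : realType} (p : nat).
Implicit Types (S : 'M[R]_p) (m x : 'cV[R]_p).

Lemma multinormal_pdf_ge0 m S x : 0 <= multinormal_pdf m S x.
Proof. by rewrite mulr_ge0 ?invr_ge0 ?sqrtr_ge0 ?expR_ge0. Qed.

Lemma measurable_multinormal_pdf m S : measurable_fun setT (multinormal_pdf m S).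
Proof.
apply: measurable_funM => //; apply: measurable_expR_qform => //.
by apply: measurable_addmx => //; exact: measurable_id.
Qed.

Lemma multinormal_norm_gt0 S : sym_posdef S -> 0 < Num.sqrt ((2 * pi) ^+ p * \det S).
Proof.
move=> pS; rewrite sqrtr_gt0 mulr_gt0 ?posdef_det_gt0//.
by rewrite exprn_gt0// mulr_gt0// pi_gt0.
Qed.

Lemma integral_multinormal_pdf m S : sym_posdef S ->
  (\int[lebesgue_cV p]_x (multinormal_pdf m S x)%:E = 1)%E.
Proof.
move=> pS; under eq_integral do rewrite /multinormal_pdf EFinM.
rewrite ge0_integralZl//=; last first.
  apply/measurable_EFinP; apply: measurable_expR_qform => //.
  by apply: measurable_addmx => //; exact: measurable_id.
rewrite integral_gauss; last exact: posdef_invmx.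
by rewrite det_inv invrK -EFinM mulVf// gt_eqF// multinormal_norm_gt0.
Qed.

(** For u the quadratic form, u exp(- u / 2) <= 4 exp(- u / 4), and the right-hand
side is Gaussian with precision halved. The determinants cancel, so the bound
depends on the dimension only. *)
Lemma integral_qform_multinormal_pdf m S : sym_posdef S ->
  (\int[lebesgue_cV p]_x (qform (invmx S) (x - m) * multinormal_pdf m S x)%:E
    <= (4 * Num.sqrt (2 ^+ p))%:E)%E.
Proof.
move=> pS; have piS := posdef_invmx pS; have dS := posdef_det_gt0 pS.
pose B := 2^-1 *: invmx S.
have pB : sym_posdef B by apply: posdefZ => //; rewrite invr_gt0.
pose C := (Num.sqrt ((2 * pi) ^+ p * \det S))^-1.
have mB : measurable_fun setT (fun x => expR (- (2^-1 * qform B (x - m)))).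
  apply: measurable_expR_qform => //.
  by apply: measurable_addmx => //; exact: measurable_id.
apply: (@le_trans _ _ (\int[lebesgue_cV p]_x ((4 * C)%:E *
    (expR (- (2^-1 * qform B (x - m))))%:E))%E).
  apply: ge0_le_integral => //.
  - by move=> x _; rewrite lee_fin mulr_ge0 ?multinormal_pdf_ge0 ?sym_posdef_ge0.
  - apply/measurable_EFinP; apply: measurable_funM; last exact: measurable_multinormal_pdf.
    apply: measurable_qform => //.
    by apply: measurable_addmx => //; exact: measurable_id.
  - by apply: measurable_funeM; exact/measurable_EFinP.
  - move=> x _; rewrite -EFinM lee_fin /multinormal_pdf -/C qform_scalem.
    set q := qform _ _.
    have -> : expR (- (2^-1 * q)) = expR (- (2^-1 * (2^-1 * q))) * expR (- (q / 4)).
      by rewrite -expRD; congr expR; field.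
    have q4 : q * expR (- (q / 4)) <= 4.
      rewrite expRN ler_pdivrMr ?expR_gt0//.
      by have := expR_ge1Dx (q / 4); lra.
    rewrite (_ : q * _ = q * expR (- (q / 4)) *
      (C * expR (- (2^-1 * (2^-1 * q))))); last by ring.
    by rewrite -[leRHS]mulrA ler_wpM2r// mulr_ge0 ?expR_ge0 ?invr_ge0 ?sqrtr_ge0.
rewrite ge0_integralZl//=; last 2 first.
- exact/measurable_EFinP.
- by rewrite lee_fin mulr_ge0 ?invr_ge0 ?sqrtr_ge0.
rewrite integral_gauss// -EFinM lee_fin -mulrA ler_wpM2l//.
rewrite /C detZ det_inv -sqrtrV; last by rewrite mulr_ge0 ?exprn_ge0 ?mulr_ge0 ?pi_ge0 ?ltW.
rewrite -sqrtrM; last first.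
  by rewrite invr_ge0 mulr_ge0 ?exprn_ge0 ?mulr_ge0 ?pi_ge0 ?ltW.
rewrite le_eqVlt; apply/orP; left; apply/eqP; congr Num.sqrt.
rewrite exprVn; field.
by rewrite gt_eqF//= !expf_neq0// mulf_neq0// gt_eqF// pi_gt0.
Qed.

(** |x|^2 <= 2 |x - m|^2 + 2 |m|^2, and the first term is compared with the
quadratic form through c. A constant c valid for a whole family of covariances
makes the bound uniform over it. *)
Lemma second_moment_multinormal_pdf m S c : sym_posdef S -> 0 <= c ->
  (forall y, enorm y ^+ 2 <= c * qform (invmx S) y) ->
  (\int[lebesgue_cV p]_x (enorm x ^+ 2 * multinormal_pdf m S x)%:E
    <= (8 * c * Num.sqrt (2 ^+ p) + 2 * enorm m ^+ 2)%:E)%E.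
Proof.
move=> pS c0 cS; have piS := posdef_invmx pS.
have mq : measurable_fun setT (fun x => qform (invmx S) (x - m)).
  apply: measurable_qform => //.
  by apply: measurable_addmx => //; exact: measurable_id.
have mpdf := measurable_multinormal_pdf m S.
apply: (@le_trans _ _ (\int[lebesgue_cV p]_x (
    (2 * c)%:E * (qform (invmx S) (x - m) * multinormal_pdf m S x)%:E
    + (2 * enorm m ^+ 2)%:E * (multinormal_pdf m S x)%:E))%E).
  apply: ge0_le_integral => //.
  - by move=> x _; rewrite lee_fin mulr_ge0 ?multinormal_pdf_ge0 ?sqr_ge0.
  - apply/measurable_EFinP; apply: measurable_funM => //.
    under eq_fun do rewrite -dotvv.
    by apply: measurable_dotv; exact: measurable_id.
  - apply: emeasurable_funD; apply: measurable_funeM; apply/measurable_EFinP => //.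
    exact: measurable_funM.
  - move=> x _; rewrite -!EFinM -EFinD lee_fin [X in _ <= X + _]mulrA -mulrDl.
    rewrite ler_wpM2r ?multinormal_pdf_ge0//.
    have := cS (x - m); rewrite -!dotvv.
    (* |x - 2 m|^2 >= 0 says that |x|^2 <= 2 |x - m|^2 + 2 |m|^2 *)
    have : 0 <= dotv (x - m - m) (x - m - m) by rewrite dotvv sqr_ge0.
    rewrite !(dotvDl, dotvDr, dotvNl, dotvNr) (dotvC m x).
    lra.
rewrite ge0_integralD//=; last 4 first.
- by move=> x _; rewrite -EFinM lee_fin !mulr_ge0 ?multinormal_pdf_ge0 ?sym_posdef_ge0.
- by apply: measurable_funeM; apply/measurable_EFinP; exact: measurable_funM.
- by move=> x _; rewrite -EFinM lee_fin !mulr_ge0 ?multinormal_pdf_ge0 ?sqr_ge0 ?sqrtr_ge0.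
- by apply: measurable_funeM; apply/measurable_EFinP.
rewrite !ge0_integralZl//=; last 6 first.
- exact/measurable_EFinP.
- by move=> x _; rewrite lee_fin multinormal_pdf_ge0.
- by rewrite lee_fin mulr_ge0 ?sqr_ge0.
- by apply/measurable_EFinP; exact: measurable_funM.
- by move=> x _; rewrite lee_fin mulr_ge0 ?multinormal_pdf_ge0 ?sym_posdef_ge0.
- by rewrite lee_fin mulr_ge0.
rewrite integral_multinormal_pdf// mule1 EFinD leeD2r//.
rewrite (_ : 8 * c * _ = 2 * c * (4 * Num.sqrt (2 ^+ p))); last by ring.
by rewrite [leRHS]EFinM lee_wpmul2l ?lee_fin ?mulr_ge0// integral_qform_multinormal_pdf.
Qed.

End multinormal_moments.

(** * The Gibbs sampler *)

Section gibbs.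
Context {R : realType} {p : nat} d (Omega : measurableType d).
Variables (Sigma0 : 'M[R]_p) (F : Omega -> 'M[R]_p) (kappa : Omega -> 'cV[R]_p)
  (mu : probability Omega R).
Hypothesis pSigma0 : sym_posdef Sigma0.
Hypothesis pF : forall omega, sym_possemidef (F omega).
Hypothesis mF : measurable_fun setT F.
Hypothesis mkappa : measurable_fun setT kappa.

Local Notation w := (gibbs_weight Sigma0 F kappa).
Local Notation Z := (gibbs_Z Sigma0 F kappa mu).
Local Notation S := (cond_cov Sigma0 F).
Local Notation m := (cond_mean Sigma0 F kappa).
Local Notation A := (fun omega => F omega + invmx Sigma0).

Lemma posdef_precision omega : sym_posdef (A omega).
Proof. by apply: posdefD => //; exact: posdef_invmx. Qed.

Lemma posdef_cond_cov omega : sym_posdef (S omega).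
Proof. by apply: posdef_invmx; exact: posdef_precision. Qed.

Lemma gibbs_weight_gt0 beta omega : 0 < w beta omega.
Proof. exact: expR_gt0. Qed.

(** Completion of the square: kappa is the image of the conditional mean under
the precision matrix. *)
Lemma gibbs_weightE beta omega : w beta omega =
  expR (2^-1 * qform (A omega) (m omega)) *
  expR (- (2^-1 * qform (invmx (S omega)) (beta - m omega))).
Proof.
have pA := posdef_precision omega; have [sA _] := pA.
have uA := posdef_unitmx pA.
rewrite -expRD /gibbs_weight invmxK; congr expR.
rewrite qformD// qformN mulmxN dotvNr mulKVmx//; lra.
Qed.

Lemma measurable_gibbs_weight :
  measurable_fun setT (fun z : 'cV[R]_p * Omega => w z.1 z.2).
Proof.
have m1 : measurable_fun setT (@fst 'cV[R]_p Omega) by exact: measurable_fst.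
have mk : measurable_fun setT (fun z : 'cV[R]_p * Omega => kappa z.2).
  by apply: measurableT_comp => //; exact: measurable_snd.
apply: measurableT_comp => //; apply: measurable_funB.
  exact: measurable_dotv.
apply: measurable_funM => //; apply: measurable_qform => //.
apply: measurable_addmx => //.
by apply: measurableT_comp => //; exact: measurable_snd.
Qed.

Let mEw : measurable_fun setT (fun z : 'cV[R]_p * Omega => (w z.1 z.2)%:E).
Proof. by apply/measurable_EFinP; exact: measurable_gibbs_weight. Qed.

Let w0 (z : 'cV[R]_p * Omega) : (0 <= (w z.1 z.2)%:E)%E.
Proof. by rewrite lee_fin ltW// gibbs_weight_gt0. Qed.

(** The unnormalized marginal density of omega. *)
Definition gibbs_omega_mass omega : \bar R := (\int[lebesgue_cV p]_x (w x omega)%:E)%E.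

Lemma measurable_gibbs_omega_mass : measurable_fun setT gibbs_omega_mass.
Proof. exact: (measurable_fun_fubini_tonelli_G _ mEw w0). Qed.

Lemma measurable_gibbs_Z : measurable_fun setT Z.
Proof. exact: (measurable_fun_fubini_tonelli_F _ mEw w0). Qed.

(** The normal density is proportional to the weight by gibbs_weightE, and the
constant is determined by its having mass one. *)
Lemma multinormal_pdf_gibbs omega : exists2 c : R, 0 < c &
  gibbs_omega_mass omega = c%:E /\
  forall x, multinormal_pdf (m omega) (S omega) x = c^-1 * w x omega.
Proof.
have pS := posdef_cond_cov omega.
pose N := Num.sqrt ((2 * pi) ^+ p * \det (S omega)).
have N0 : 0 < N by exact: multinormal_norm_gt0.
pose e := expR (2^-1 * qform (A omega) (m omega)).
have e0 : 0 < e by exact: expR_gt0.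
have pdfE x : multinormal_pdf (m omega) (S omega) x = (N * e)^-1 * w x omega.
  rewrite gibbs_weightE /multinormal_pdf -/N -/e; field.
  by rewrite !gt_eqF.
exists (N * e); first exact: mulr_gt0.
split=> //; rewrite -[RHS]mule1 -(integral_multinormal_pdf (m omega) pS).
rewrite -ge0_integralZl//=; last 3 first.
- by apply/measurable_EFinP; exact: measurable_multinormal_pdf.
- by move=> x _; rewrite lee_fin multinormal_pdf_ge0.
- by rewrite lee_fin ltW// mulr_gt0.
apply: eq_integral => x _; rewrite pdfE -EFinM mulVKf// gt_eqF// mulr_gt0//.
Qed.

(** Joint measurability is read off the quotient of the weight by its integral
over beta, which Tonelli makes measurable in omega, and not off the inverse
matrix and the determinant in the formula of the density. *)
Lemma measurable_cond_pdf : measurable_fun setT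
  (fun z : Omega * 'cV[R]_p => multinormal_pdf (m z.1) (S z.1) z.2).
Proof.
rewrite (_ : (fun _ => _) = fun z => (fine (gibbs_omega_mass z.1))^-1 * w z.2 z.1); last first.
  apply/funext => z; have [c c0 [-> ->]] := multinormal_pdf_gibbs z.1.
  by [].
(* the inverse of a nonnegative function is its power -1 *)
have mWV : measurable_fun setT (fun omega => (fine (gibbs_omega_mass omega))^-1).
  rewrite (_ : (fun _ => _) = (@powR R ^~ (-1)) \o (fine \o gibbs_omega_mass)).
    apply: measurableT_comp; first exact: measurable_powR.
    by apply: measurableT_comp => //; exact: measurable_gibbs_omega_mass.
  apply/funext => o; rewrite /= powR_inv1// fine_ge0// integral_ge0// => x _.
  by rewrite lee_fin ltW// gibbs_weight_gt0.
apply: measurable_funM; first exact: (measurableT_comp mWV measurable_fst).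
exact: (measurableT_comp measurable_gibbs_weight (@measurable_swap _ _ _ _)).
Qed.

Hypothesis Zfin : forall beta, Z beta \is a fin_num.

Lemma gibbs_Z_gt0 beta : 0 < fine (Z beta).
Proof.
rewrite fine_gt0//; apply/andP; split; last by rewrite ltey_eq Zfin.
apply: integral_gt0 => //.
- exact: (measurableT_comp mEw (measurable_pair1 beta)).
- by move=> omega; rewrite lte_fin gibbs_weight_gt0.
by rewrite [X in X != _](probability_setT mu).
Qed.

Lemma cond_omega_mass beta :
  (\int[mu]_omega ((fine (Z beta))^-1 * w beta omega)%:E = 1)%E.
Proof.
under eq_integral do rewrite EFinM.
rewrite ge0_integralZl//=; last 3 first.
- exact: (measurableT_comp mEw (measurable_pair1 beta)).
- by move=> omega _; exact: (w0 (beta, omega)).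
- by rewrite lee_fin invr_ge0 ltW// gibbs_Z_gt0.
by rewrite -/(Z beta) -(fineK (Zfin beta)) -EFinM mulVf// gt_eqF// gibbs_Z_gt0.
Qed.

Let cond_omega_density (z : 'cV[R]_p * Omega) := (fine (Z z.1))^-1 * w z.1 z.2.

Let cond_omega_density_ge0 z : 0 <= cond_omega_density z.
Proof.
by rewrite mulr_ge0 ?invr_ge0// ltW ?gibbs_Z_gt0 ?gibbs_weight_gt0.
Qed.

Let measurable_cond_omega_density : measurable_fun setT cond_omega_density.
Proof.
apply: measurable_funM; last exact: measurable_gibbs_weight.
have mZV : measurable_fun setT (fun beta => (fine (Z beta))^-1).
  rewrite (_ : (fun _ => _) = (@powR R ^~ (-1)) \o (fine \o Z)).
    apply: measurableT_comp; first exact: measurable_powR.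
    by apply: measurableT_comp => //; exact: measurable_gibbs_Z.
  by apply/funext => o; rewrite /= powR_inv1// ltW// gibbs_Z_gt0.
exact: (measurableT_comp mZV measurable_fst).
Qed.

Let cond_beta_density (z : Omega * 'cV[R]_p) := multinormal_pdf (m z.1) (S z.1) z.2.

Let cond_beta_density_ge0 z : 0 <= cond_beta_density z.
Proof. exact: multinormal_pdf_ge0. Qed.

Definition cond_omega_kernel : R.-pker 'cV[R]_p ~> Omega :=
  @pdensity _ _ _ _ R mu cond_omega_density cond_omega_density_ge0
    measurable_cond_omega_density cond_omega_mass.

Let cond_beta_mass omega :
  (\int[lebesgue_cV p]_x (multinormal_pdf (m omega) (S omega) x)%:E = 1)%E.
Proof. by apply: integral_multinormal_pdf; exact: posdef_cond_cov. Qed.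

Definition cond_beta_kernel : R.-pker Omega ~> 'cV[R]_p :=
  @pdensity _ _ _ _ R (lebesgue_cV p) cond_beta_density cond_beta_density_ge0
    measurable_cond_pdf cond_beta_mass.

Definition gibbs_pker : R.-pker 'cV[R]_p ~> 'cV[R]_p :=
  mkcomp_noparam cond_omega_kernel cond_beta_kernel.

Lemma integral_cond_omega_kernel beta (f : Omega -> \bar R) :
  (forall omega, 0 <= f omega)%E -> measurable_fun setT f ->
  (\int[cond_omega_kernel beta]_omega f omega =
   \int[mu]_omega (((fine (Z beta))^-1 * w beta omega)%:E * f omega))%E.
Proof.
move=> f0 mf; exact: (@integral_kdensity _ _ _ _ R mu cond_omega_density
  cond_omega_density_ge0 measurable_cond_omega_density beta f f0 mf).
Qed.

Lemma integral_cond_beta_kernel omega (f : 'cV[R]_p -> \bar R) :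
  (forall x, 0 <= f x)%E -> measurable_fun setT f ->
  (\int[cond_beta_kernel omega]_x f x =
   \int[lebesgue_cV p]_x ((multinormal_pdf (m omega) (S omega) x)%:E * f x))%E.
Proof.
move=> f0 mf; exact: (@integral_kdensity _ _ _ _ R (lebesgue_cV p) cond_beta_density
  cond_beta_density_ge0 measurable_cond_pdf omega f f0 mf).
Qed.

Lemma measurable_cond_beta_integral (f : 'cV[R]_p -> \bar R) :
  (forall x, 0 <= f x)%E -> measurable_fun setT f ->
  measurable_fun setT (fun omega => \int[cond_beta_kernel omega]_x f x)%E.
Proof.
move=> f0 mf; apply: measurable_fun_integral_kernel => // U mU.
exact: measurable_kernel.
Qed.

Lemma markov_op_gibbs_pker beta (f : 'cV[R]_p -> \bar R) :
  (forall x, 0 <= f x)%E -> measurable_fun setT f ->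
  (markov_op gibbs_pker f beta = ((fine (Z beta))^-1)%:E *
   \int[mu]_omega ((w beta omega)%:E * \int[cond_beta_kernel omega]_x f x))%E.
Proof.
move=> f0 mf; rewrite /markov_op [LHS]integral_mkcomp_noparam//.
have N0 omega : (0 <= \int[cond_beta_kernel omega]_x f x)%E by exact: integral_ge0.
have mN := measurable_cond_beta_integral f0 mf.
rewrite integral_cond_omega_kernel// -ge0_integralZl//; last 3 first.
- apply: emeasurable_funM => //; exact: (measurableT_comp mEw (measurable_pair1 beta)).
- by move=> omega _; rewrite mule_ge0//; exact: (w0 (beta, omega)).
- by rewrite lee_fin invr_ge0 ltW// gibbs_Z_gt0.
by apply: eq_integral => omega _; rewrite EFinM muleA.
Qed.

Section target.
Variable Pi : probability ('cV[R]_p * Omega)%type R.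
Hypothesis PiE : gibbs_target Sigma0 F kappa mu Pi.

(** The density w / Z of omega given beta cancels the factor Z that integrating
omega out produces; the normal density cancels gibbs_omega_mass in the same way
after the exchange of the two integrals. *)
Lemma gibbs_pker_invariant (f : 'cV[R]_p -> \bar R) :
  (forall x, 0 <= f x)%E -> measurable_fun setT f ->
  (\int[Pi]_z markov_op gibbs_pker f z.1 = \int[Pi]_z f z.1)%E.
Proof.
move=> f0 mf; have [c c0 Pi_c] := PiE.
(* N omega is the mean of f given omega *)
have [N [N0 mN NE kE]] : exists N : Omega -> \bar R,
    [/\ (forall omega, 0 <= N omega)%E, measurable_fun setT N,
     (forall omega, N omega = \int[lebesgue_cV p]_x
        ((multinormal_pdf (m omega) (S omega) x)%:E * f x))%E &
     (forall beta, markov_op gibbs_pker f beta = ((fine (Z beta))^-1)%:E *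
        \int[mu]_omega ((w beta omega)%:E * N omega))%E].
  exists (fun omega => \int[cond_beta_kernel omega]_x f x)%E; split.
  - by move=> omega; exact: integral_ge0.
  - exact: measurable_cond_beta_integral.
  - by move=> omega; exact: integral_cond_beta_kernel.
  - by move=> beta; exact: markov_op_gibbs_pker.
have mw1 beta : measurable_fun setT (fun omega => (w beta omega)%:E).
  exact: (measurableT_comp mEw (measurable_pair1 beta)).
have mw2 omega : measurable_fun setT (fun beta => (w beta omega)%:E).
  exact: (measurableT_comp mEw (measurable_pair2 omega)).
have w0' beta omega : (0 <= (w beta omega)%:E)%E by exact: (w0 (beta, omega)).
have PiI (g : 'cV[R]_p * Omega -> \bar R) : (forall z, 0 <= g z)%E ->
    measurable_fun setT g ->
    (\int[Pi]_z g z = c%:E * \int[lebesgue_cV p \x mu]_z ((w z.1 z.2)%:E * g z))%E.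
  move=> g0 mg.
  rewrite (@ge0_integral_density _ _ R (lebesgue_cV p \x mu)%E Pi
    (fun z => c * w z.1 z.2))//; last 3 first.
  - by move=> z; rewrite mulr_ge0 ?ltW ?gibbs_weight_gt0.
  - by apply: measurable_funM => //; exact: measurable_gibbs_weight.
  - move=> B mB; apply: (eq_trans (Pi_c B mB)); rewrite -ge0_integralZl//; last 2 first.
    + exact: measurable_funTS.
    + by rewrite lee_fin ltW.
  rewrite -ge0_integralZl//; last 3 first.
  - exact: emeasurable_funM.
  - by move=> z _; exact: mule_ge0.
  - by rewrite lee_fin ltW.
  by apply: eq_integral => z _; rewrite EFinM muleA.
have mkf : measurable_fun setT (markov_op gibbs_pker f) by exact: measurable_markov_op.
have kf0 x : (0 <= markov_op gibbs_pker f x)%E by exact: markov_op_ge0.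
have mkf1 : measurable_fun setT (fun z : 'cV[R]_p * Omega => markov_op gibbs_pker f z.1).
  exact: (measurableT_comp mkf measurable_fst).
have mf1 : measurable_fun setT (fun z : 'cV[R]_p * Omega => f z.1).
  exact: (measurableT_comp mf measurable_fst).
rewrite (PiI _ (fun z => kf0 z.1) mkf1) (PiI _ (fun z => f0 z.1) mf1).
congr (_ * _)%E.
move: (markov_op gibbs_pker f) kE mkf kf0 mkf1 => k kE mk k0 mk1.
rewrite (fubini_tonelli1 (fun z => (w z.1 z.2)%:E * k z.1)%E); last 2 first.
- exact: emeasurable_funM.
- by move=> z; exact: mule_ge0.
transitivity (\int[lebesgue_cV p]_beta \int[mu]_omega ((w beta omega)%:E * N omega))%E.
  apply: eq_integral => beta _; rewrite /fubini_F /=.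
  rewrite ge0_integralZr// -/(Z beta) kE muleA -{1}(fineK (Zfin beta)) -EFinM.
  by rewrite divff ?mul1e// gt_eqF// gibbs_Z_gt0.
rewrite (fubini_tonelli (fun z => (w z.1 z.2)%:E * N z.2)%E)/=; last 2 first.
- apply: emeasurable_funM => //; exact: (measurableT_comp mN measurable_snd).
- by move=> z; exact: (mule_ge0 (w0 z) (N0 z.2)).
rewrite (fubini_tonelli2 (fun z => (w z.1 z.2)%:E * f z.1)%E); last 2 first.
- exact: emeasurable_funM.
- by move=> z; exact: mule_ge0.
apply: eq_integral => omega _; rewrite /fubini_G /=.
rewrite ge0_integralZr// -/(gibbs_omega_mass omega) NE.
have [a a0 [-> pdfE]] := multinormal_pdf_gibbs omega.
rewrite -ge0_integralZl//; last 3 first.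
- by apply: emeasurable_funM => //; apply/measurable_EFinP; exact: measurable_multinormal_pdf.
- by move=> x _; rewrite mule_ge0// lee_fin multinormal_pdf_ge0.
- by rewrite lee_fin ltW.
apply: eq_integral => x _; rewrite pdfE muleA -EFinM mulVKf//.
by rewrite gt_eqF.
Qed.

End target.

Section drift.
Variable M : R.
Hypothesis mM : forall omega, enorm (m omega) <= M.

(** The bound of second_moment_multinormal_pdf with c = tr Sigma0; adding 1 keeps
it positive when p = 0. *)
Definition gibbs_drift := 8 * \tr Sigma0 * Num.sqrt (2 ^+ p) + 2 * M ^+ 2 + 1.

Lemma tr_Sigma0_ge0 : 0 <= \tr Sigma0.
Proof.
apply: sumr_ge0 => i _; have := sym_posdef_ge0 (delta_mx i ord0) pSigma0.
by rewrite /qform trmx_delta -rowE -colE !mxE.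
Qed.

Lemma gibbs_drift_gt0 : 0 < gibbs_drift.
Proof.
rewrite ltr_wpDl// addr_ge0//; last by rewrite mulr_ge0 ?sqr_ge0.
by rewrite !mulr_ge0 ?sqrtr_ge0 ?tr_Sigma0_ge0.
Qed.

Let mV : measurable_fun setT (fun x : 'cV[R]_p => enorm x ^+ 2).
Proof. exact: measurable_enorm_sqr. Qed.

(** As F(omega) is positive semidefinite, every precision matrix dominates
Sigma0^-1, so c = tr Sigma0 serves for all omega at once. *)
Lemma gibbs_pker_drift beta :
  (\int[gibbs_pker beta]_x (enorm x ^+ 2)%:E <= gibbs_drift%:E)%E.
Proof.
have mEV : measurable_fun setT (fun x : 'cV[R]_p => (enorm x ^+ 2)%:E).
  exact/measurable_EFinP.
have V0 (x : 'cV[R]_p) : (0 <= (enorm x ^+ 2)%:E)%E by rewrite lee_fin sqr_ge0.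
rewrite [leLHS]integral_mkcomp_noparam//.
apply: (@le_trans _ _ (\int[cond_omega_kernel beta]__ gibbs_drift%:E)%E).
  apply: ge0_le_integral => //.
  - by move=> omega _; exact: integral_ge0.
  - exact: measurable_cond_beta_integral.
  - move=> omega _; rewrite integral_cond_beta_kernel//.
    have c0 := tr_Sigma0_ge0.
    have cS y : enorm y ^+ 2 <= \tr Sigma0 * qform (invmx (S omega)) y.
      apply: (le_trans (enorm_sqr_le y pSigma0)); rewrite ler_wpM2l//.
      rewrite invmxK qform_addm lerDr; have [_] := pF omega; exact.
    have := second_moment_multinormal_pdf (m omega) (posdef_cond_cov omega) c0 cS.
    under eq_integral do rewrite EFinM muleC; move/le_trans; apply.
    rewrite lee_fin /gibbs_drift ler_wpDr// lerD2l ler_wpM2l//.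
    by rewrite ler_sqr ?nnegrE ?sqrtr_ge0// (le_trans _ (mM omega))// sqrtr_ge0.
by rewrite integral_cst// prob_kernel mule1.
Qed.

(** Chebyshev: 1 <= 1_C + |x|^2 / (2 K), integrated with the drift bound. *)
Lemma gibbs_pker_ball beta :
  ((2^-1)%:E <= gibbs_pker beta [set x | (enorm x ^+ 2 <= 2 * gibbs_drift)%R])%E.
Proof.
set K := gibbs_drift; have K0 : 0 < K by exact: gibbs_drift_gt0.
set C := [set x | _].
have mC : measurable C by exact: measurable_enorm_ball.
have V0 (x : 'cV[R]_p) : (0 <= (enorm x ^+ 2)%:E)%E by rewrite lee_fin sqr_ge0.
have mEV : measurable_fun setT (fun x : 'cV[R]_p => (enorm x ^+ 2)%:E).
  exact/measurable_EFinP.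
have : (1 <= gibbs_pker beta C + (2 * K)^-1%:E * \int[gibbs_pker beta]_x (enorm x ^+ 2)%:E)%E.
  rewrite -ge0_integralZl//; last by rewrite lee_fin invr_ge0 mulr_ge0// ltW.
  rewrite -[X in gibbs_pker beta X]setIT -integral_indic//.
  rewrite -ge0_integralD//; last 3 first.
  - by apply/measurable_EFinP.
  - by move=> x _; rewrite mule_ge0// lee_fin invr_ge0 mulr_ge0// ltW.
  - exact: measurable_funeM.
  apply: (@le_trans _ _ (\int[gibbs_pker beta]__ 1)%E).
    by rewrite integral_cst// prob_kernel mule1.
  apply: ge0_le_integral => //.
  - by apply: emeasurable_funD; [exact/measurable_EFinP|exact: measurable_funeM].
  move=> x _; rewrite -EFinM -EFinD lee_fin indicE.
  case: (boolP (x \in C)) => [_|].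
    by rewrite lerDl mulr_ge0 ?sqr_ge0// invr_ge0 mulr_ge0// ltW.
  rewrite notin_setE => /negP; rewrite -ltNge => xC.
  by rewrite add0r mulrC ler_pdivlMr ?mulr_gt0// mul1r ltW.
have K2 : ((2 * K)^-1%:E * \int[gibbs_pker beta]_x (enorm x ^+ 2)%:E <= (2^-1)%:E)%E.
  have -> : (2^-1 : R)%:E = ((2 * K)^-1%:E * K%:E)%E.
    by rewrite -EFinM; congr EFin; field; rewrite gt_eqF.
  by rewrite lee_wpmul2l ?gibbs_pker_drift// lee_fin invr_ge0 mulr_ge0// ltW.
move=> /le_trans/(_ (leeD2l _ K2)); rewrite -leeBlDr// -EFinB.
by apply: le_trans; rewrite lee_fin; lra.
Qed.

Section minorization.
Hypothesis cZ : continuous (fun beta => fine (Z beta)).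

(** F and kappa may be unbounded, so there may be no positive lower bound common
to all omega; a positive bound for each omega suffices, as its integral is then
positive. *)
Lemma gibbs_weight_lower_bound (rho : R) : exists2 g : Omega -> R,
  measurable_fun setT g & forall omega, 0 < g omega /\
    forall beta, enorm beta ^+ 2 <= rho -> g omega <= w beta omega.
Proof.
pose a omega := \sum_i \sum_j `|A omega i j|.
exists (fun omega => expR (- (2^-1 * (rho + dotv (kappa omega) (kappa omega)
  + a omega * rho)))).
  have mA : measurable_fun setT A by exact: measurable_addmx.
  apply: measurableT_comp => //; apply: measurableT_comp => //.
  apply: measurable_funM => //; apply: measurable_funD.
    by apply: measurable_funD => //; exact: measurable_dotv.
  apply: measurable_funM => //.
  apply: measurable_sum => i; apply: measurable_sum => j.
  by apply: measurableT_comp => //; exact: measurable_mx_coef.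
move=> omega; split=> [|beta br]; first exact: expR_gt0.
rewrite /gibbs_weight ler_expR.
have q := qform_le (A omega) beta; rewrite -/(a omega) in q.
have a0 : 0 <= a omega by apply: sumr_ge0 => i _; apply: sumr_ge0.
have {}q : qform (A omega) beta <= a omega * rho.
  by apply: (le_trans q); rewrite ler_wpM2l.
(* beta.kappa >= - (|beta|^2 + |kappa|^2) / 2 *)
have : 0 <= dotv (beta + kappa omega) (beta + kappa omega) by rewrite dotvv sqr_ge0.
rewrite !(dotvDl, dotvDr) (dotvC _ beta) dotvv; lra.
Qed.

(** Here nu = (2 B)^-1 int g(omega) N(m(omega), S(omega)) mu, with B a bound of Z
on the ball. The factor 1/2 is the probability of reaching the ball in one step.
Since 0 is in the ball, int g <= Z(0) <= B, so the mass of nu is at most 1/2. *)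
Lemma gibbs_pker_minorization : exists (nu : {measure set 'cV[R]_p -> \bar R})
  (alpha : R), [/\ 0 < alpha < 1, nu setT = alpha%:E &
    forall x U, measurable U -> (nu U <= kernel_pow gibbs_pker 2 x U)%E].
Proof.
set K := gibbs_drift; have K0 : 0 < K by exact: gibbs_drift_gt0.
pose C := [set x : 'cV[R]_p | enorm x ^+ 2 <= 2 * K].
have mC : measurable C by exact: measurable_enorm_ball.
have [g mg gP] := gibbs_weight_lower_bound (2 * K).
have [B0 ZB0] := continuous_bounded_ball (2 * K) cZ.
have ZB beta : C beta -> fine (Z beta) <= B0.
  by move=> /ZB0; apply: le_trans; exact: ler_norm.
have C0 : C 0.
  by rewrite /C /= -dotvv /dotv mulmx0 mxE mulr_ge0// ltW.
have B0_gt0 : 0 < B0 by apply: lt_le_trans (ZB _ C0); exact: gibbs_Z_gt0.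
pose h (z : unit * Omega) := (2 * B0)^-1 * g z.2.
have g0 omega : 0 < g omega by have [] := gP omega.
have h0 z : 0 <= h z by rewrite mulr_ge0 ?invr_ge0 ?mulr_ge0// ltW.
have mh : measurable_fun setT h.
  by apply: measurable_funM => //; exact: measurableT_comp.
pose nu := (mkdensity mu h0 mh \; kernel.kernel_snd cond_beta_kernel)%E tt.
have mEg : measurable_fun setT (EFin \o g) by exact/measurable_EFinP.
have Eg0 omega : (0 <= (g omega)%:E)%E by rewrite lee_fin ltW.
have nuE U : measurable U -> nu U = ((2 * B0)^-1%:E *
    \int[mu]_omega ((g omega)%:E * cond_beta_kernel omega U))%E.
  move=> mU.
  have mk : measurable_fun setT (cond_beta_kernel ^~ U) by exact: measurable_kernel.
  change (\int[mkdensity mu h0 mh tt]_omega cond_beta_kernel omega U =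
    (2 * B0)^-1%:E * \int[mu]_omega ((g omega)%:E * cond_beta_kernel omega U))%E.
  rewrite integral_kdensity// -ge0_integralZl//; last 3 first.
  - exact: emeasurable_funM.
  - by move=> omega _; rewrite mule_ge0.
  - by rewrite lee_fin invr_ge0 mulr_ge0// ltW.
  by apply: eq_integral => omega _; rewrite EFinM muleA.
have intg : (\int[mu]_omega (g omega)%:E <= B0%:E)%E.
  apply: (@le_trans _ _ (Z 0)); last by rewrite -(fineK (Zfin 0)) lee_fin ZB.
  apply: ge0_le_integral => //.
  - exact: (measurableT_comp mEw (measurable_pair1 (0 : 'cV[R]_p))).
  - by move=> omega _; rewrite lee_fin; have [_] := gP omega; apply; exact: C0.
have intg0 : (0 < \int[mu]_omega (g omega)%:E)%E.
  by apply: integral_gt0 => //; rewrite [X in X != _](probability_setT mu).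
have intgfin : (\int[mu]_omega (g omega)%:E \is a fin_num)%E.
  by rewrite ge0_fin_numE ?(le_lt_trans intg) ?ltry// ltW.
exists nu, ((2 * B0)^-1 * fine (\int[mu]_omega (g omega)%:E)); split.
- have f0 : 0 < fine (\int[mu]_omega (g omega)%:E) by rewrite fine_gt0// intg0 ltey_eq intgfin.
  have fB : fine (\int[mu]_omega (g omega)%:E) <= B0 by rewrite -lee_fin fineK.
  rewrite mulr_gt0 ?invr_gt0 ?mulr_gt0//= mulrC ltr_pdivrMr ?mulr_gt0//; lra.
- rewrite nuE// EFinM fineK//; congr (_ * _)%E.
  by apply: eq_integral => omega _; rewrite prob_kernel mule1.
move=> x U mU.
pose I := (\int[mu]_omega ((g omega)%:E * cond_beta_kernel omega U))%E.
have I0 : (0 <= I)%E by apply: integral_ge0 => omega _; exact: mule_ge0.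
have U0 (y : 'cV[R]_p) : (0 <= (\1_U y : R)%:E)%E by rewrite lee_fin.
have mU1 : measurable_fun setT (fun y : 'cV[R]_p => (\1_U y : R)%:E).
  by apply/measurable_EFinP.
rewrite kernel_pow_indic//=.
have step y : C y -> ((B0^-1)%:E * I <= markov_op gibbs_pker (fun y => (\1_U y)%:E) y)%E.
  move=> Cy; rewrite markov_op_gibbs_pker//; apply: lee_pmul => //.
  - by rewrite lee_fin invr_ge0 ltW.
  - by rewrite lee_fin lef_pV2 ?posrE ?gibbs_Z_gt0// ZB.
  - apply: ge0_le_integral => //.
    + by move=> omega _; exact: mule_ge0.
    + by apply: emeasurable_funM => //; exact: measurable_kernel.
    + apply: emeasurable_funM; last exact: measurable_cond_beta_integral.
      exact: (measurableT_comp mEw (measurable_pair1 y)).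
    + move=> omega _; rewrite integral_indic// setIT lee_wpmul2r//.
      by rewrite lee_fin; have [_] := gP omega; exact.
rewrite nuE// -/I.
apply: (@le_trans _ _ (\int[gibbs_pker x]_y ((B0^-1)%:E * I * (\1_C y)%:E))%E).
  rewrite ge0_integralZl//; last 2 first.
  - by apply/measurable_EFinP.
  - by rewrite mule_ge0// lee_fin invr_ge0 ltW.
  rewrite integral_indic// setIT invfM EFinM -muleA muleC.
  by rewrite lee_wpmul2l ?gibbs_pker_ball// mule_ge0// lee_fin invr_ge0 ltW.
apply: ge0_le_integral => //.
- by move=> y _; rewrite !mule_ge0// lee_fin invr_ge0 ltW.
- by apply: emeasurable_funM => //; apply/measurable_EFinP.
- exact: measurable_markov_op.
- move=> y _; rewrite indicE; case: (boolP (y \in C)) => [/set_mem yC|_].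
    by rewrite mule1; exact: step.
  by rewrite mule0; apply: markov_op_ge0.
Qed.

End minorization.

End drift.

End gibbs.

HB.instance Definition _ d1 d2 (T1 : measurableType d1) (T2 : measurableType d2) :=
  isMeasurableFun.Build _ _ _ _ (@fst T1 T2) measurable_fst.

Theorem theorem5p1 (R : realType) (p : nat)
    (d : measure_display) (Omega : measurableType d)
    (Sigma0 : 'M[R]_p) (mu : probability Omega R)
    (F : Omega -> 'M[R]_p) (kappa : Omega -> 'cV[R]_p)
    (Pi : probability ('cV[R]_p * Omega)%type R) :
  sym_posdef Sigma0 ->
  (forall omega, sym_possemidef (F omega)) ->
  measurable_fun setT F ->
  measurable_fun setT kappa ->
  gibbs_target Sigma0 F kappa mu Pi ->
  has_ubound [set enorm (cond_mean Sigma0 F kappa omega) | omega in setT] ->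
  (forall beta, gibbs_Z Sigma0 F kappa mu beta \is a fin_num) ->
  continuous (fun beta => fine (gibbs_Z Sigma0 F kappa mu beta)) ->
  hyper_uniformly_ergodic (fun beta : 'cV[R]_p => enorm beta ^+ 2)
    (gibbs_kernel Sigma0 F kappa mu) (fun B => Pi (B `*` setT)).
Proof.
move=> pS pF mF mk PiE [M Mub] Zfin cZ.
have mM omega : enorm (cond_mean Sigma0 F kappa omega) <= M by apply: Mub; exists omega.
have [nu [alpha [a01 nuT nuP]]] := gibbs_pker_minorization pS pF mF mk Zfin mM cZ.
apply: (hyper_uniformly_ergodic_drift_minorization
  (P := gibbs_pker pS pF mF mk Zfin)
  (pi := distribution Pi (@fst 'cV[R]_p Omega)) a01 nuT nuP).
- move=> f f0 mf.
  pose P := gibbs_pker pS pF mF mk Zfin.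
  rewrite (ge0_integral_distribution (P := Pi) (@fst 'cV[R]_p Omega)
    (measurable_markov_op P f0 mf) (markov_op_ge0 P f0)).
  rewrite (ge0_integral_distribution (P := Pi) (@fst 'cV[R]_p Omega) mf f0).
  exact: gibbs_pker_invariant.
- exact: measurable_enorm_sqr.
- by move=> x; exact: sqr_ge0.
- exact: (gibbs_drift_gt0 pS M).
- by move=> x; exact: gibbs_pker_drift.
- by [].
- move=> B mB; congr (Pi _); apply/seteqP; split=> [[x o] []//|[x o] //=].
Qed.
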